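(* Let $c\in\mathbb{C}(t)$ with $c\notin\{0,1,t\}$, let $C$ be a homogeneous lift of $c$, set $F_1=F_{t_1,t_2}(C)/\gcd(F_{t_1,t_2}(C))$, $d=\deg F_1$, and $F_{n+1}=F_{t_1,t_2}(F_n)/t_2^2$ for all $n\ge1$, so that $\deg F_n=4^{n-1}d$. Then the sequence $\frac{1}{\deg F_n}\log\|F_n(t_1,t_2)\|$ converges locally uniformly on $\mathbb{C}^2\setminus\{(0,0)\}$, as $n\to\infty$, to a continuous plurisubharmonic function $G_C$.
   Context: For $(t_1,t_2),(z,w)\in\mathbb{C}^2$ let $F_{t_1,t_2}(z,w)=\big((t_1w^2-t_2z^2)^2,\;4t_2zw(w-z)(t_1w-t_2z)\big)$, a homogenization of the Lattès map $f_t(z)=\frac{(z^2-t)^2}{4z(z-1)(z-t)}$, $t=t_1/t_2$. A homogeneous lift of $c\in\mathbb{C}(t)$ is a pair $C=(c_1,c_2)$ of homogeneous polynomials in $(t_1,t_2)$ of the same degree with no common factor such that $c(t)=c_1(t,1)/c_2(t,1)$. For a pair $F=(P,Q)$ of homogeneous polynomials in $(t_1,t_2)$ of the same degree, $\deg F$ denotes this degree and $\gcd(F)$ the gcd of $P$ and $Q$; $F_{t_1,t_2}(F)$ means substituting $(z,w)=(P,Q)$. The norm is $\|(z,w)\|=\max\{|z|,|w|\}$. *)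

(* Defs.v *)
From HB Require Import structures.
From mathcomp Require Import all_boot all_order all_algebra.
From mathcomp Require Import all_classical all_reals all_analysis.
From mathcomp Require Import complex.
Set Implicit Arguments. Unset Strict Implicit. Unset Printing Implicit Defensive.
Import Order.TTheory GRing.Theory Num.Theory.
Local Open Scope ring_scope.

Notation "x %:F" := (@FracField.tofrac _ x) : ring_scope.

Section Defs.
Variable R : realType.
Local Notation C := R[i].

(* polynomials in C[t1,t2], represented (as in polyXY) as polynomials in t2
   whose coefficients are polynomials in t1:  P = \sum_j P`_j(t1) t2^j *)
Definition bipoly := {poly {poly C}}.

Definition t1 : bipoly := ('X)%:P.
Definition t2 : bipoly := 'X.

(* P is homogeneous of (total) degree d: every monomial t1^i t2^j with a
   nonzero coefficient has i + j = d (the zero polynomial is homogeneous of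
   every degree) *)
Definition homog (P : bipoly) (d : nat) : Prop :=
  forall i j : nat, (P`_j)`_i != 0 -> (i + j)%N = d.

Definition bdvd (g P : bipoly) : Prop := exists q : bipoly, P = q * g.

Definition no_common_factor (P Q : bipoly) : Prop :=
  forall g : bipoly, bdvd g P -> bdvd g Q ->
    exists a : C, a != 0 /\ g = (a%:P)%:P.

Definition dehom (P : bipoly) : {poly C} := P.[1].

Definition homogeneous_lift (c : {fraction {poly C}}) (c1 c2 : bipoly) : Prop :=
  exists k : nat, [/\ homog c1 k, homog c2 k, no_common_factor c1 c2,
     dehom c2 != 0 & c = (dehom c1)%:F / (dehom c2)%:F].

(* the homogenized Lattes map F_{t1,t2} applied to a pair of polynomials *)
Definition Fmap (F : bipoly * bipoly) : bipoly * bipoly :=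
  let z := F.1 in let w := F.2 in
  ((t1 * w ^+ 2 - t2 * z ^+ 2) ^+ 2,
   4%:R * t2 * z * w * (w - z) * (t1 * w - t2 * z)).

Definition ev (P : bipoly) (x : C * C) : C :=
  (map_poly (fun q : {poly C} => q.[x.1]) P).[x.2].

Definition evF (F : bipoly * bipoly) (x : C * C) : C * C := (ev F.1 x, ev F.2 x).

Definition cabs (z : C) : R := ComplexField.Normc.normc z.

Definition cnorm (x : C * C) : R := Num.max (cabs x.1) (cabs x.2).

Definition cdist (x y : C * C) : R := cnorm (x.1 - y.1, x.2 - y.2).

Definition punct (x : C * C) : Prop := x <> (0, 0).

Definition continuous_on_punct (G : C * C -> R) : Prop :=
  forall x, punct x -> forall e : R, 0 < e -> exists2 r : R, 0 < r &
    forall y, punct y -> cdist y x < r -> `|G y - G x| < e.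

Definition expi (th : R) : C := Complex (cos th) (sin th).

(* plurisubharmonic on C^2 \ {0}: upper semicontinuous (here G is even
   assumed continuous) and satisfying the sub-mean value inequality on every
   closed complex disc { a + lambda b : |lambda| <= 1 } contained in the domain *)
Definition psh_on_punct (G : C * C -> R) : Prop :=
  (forall x, punct x -> forall e : R, 0 < e -> exists2 r : R, 0 < r &
      forall y, punct y -> cdist y x < r -> G y < G x + e) /\
  (forall a b : C * C,
     (forall l : C, cabs l <= 1 -> punct (a.1 + l * b.1, a.2 + l * b.2)) ->
     G a <= (2 * pi)^-1 *
       Rintegral lebesgue_measure `[0, 2 * pi]%classic
         (fun th : R => G (a.1 + expi th * b.1, a.2 + expi th * b.2))).

Definition loc_unif_cvg_punct (u : nat -> C * C -> R) (G : C * C -> R) : Prop :=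
  forall x, punct x -> exists2 r : R, 0 < r &
    forall e : R, 0 < e -> exists N : nat, forall n, (N <= n)%N ->
      forall y, punct y -> cdist y x < r -> `|u n y - G y| < e.

End Defs.

(* Main.v *)
(* The second component of F_n is divisible by t2; writing F_n = (A_n, t2 B_n),
   the recursion becomes (A, B) |-> ((A^2 - t1 t2 B^2)^2,
   4 A B (A - t1 B) (A - t2 B)), the duplication map of the curve
   y^2 = x (x - t1) (x - t2), which is symmetric in t1 and t2. Its fibres over
   t1 = 0, t2 = 0 and t1 = t2 are nodal, and translation by the 2-torsion point
   x = t1 turns the third case into the other two.

   Consider duplication on y^2 = x (x - a) (x - b), with |b| and |a - b| bounded
   below and |a|, |b| bounded above, for v = (A, B) of norm N = max (|A|, |B|).
   Put r = max (|A|^2, |a| N^2) / N^2. The node x = 0 of the fibre a = 0 is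
   superattracting, and an elementary computation gives, uniformly in a, that
   r' >= c r^2 and c r^2 N^4 <= N' <= C N^4 for the image of v. Hence
   log r_n >= - K 2^n, so that |log N_{n+1} - 4 log N_n| <= K' 2^n, and dividing by
   4^n yields geometric, locally uniform convergence. The only thing to check is
   that r_0 > 0, i.e. that F_1 does not meet the node on a degenerate fibre: doubling
   sends the other component of the special fibre to the identity component,
   which is a computation of orders of vanishing along the three lines.

   Each log ||F_n|| satisfies the sub-mean value inequality and so does the limit. *)
Require Import Defs.
From HB Require Import structures.
From mathcomp Require Import all_boot all_order all_algebra.
From mathcomp Require Import all_classical all_reals all_analysis.
From mathcomp Require Import complex.
From mathcomp Require Import ring lra zify.
Set Implicit Arguments. Unset Strict Implicit. Unset Printing Implicit Defensive.
Import Order.TTheory GRing.Theory Num.Theory.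
Local Open Scope ring_scope.

(** * Moduli of complex numbers *)

Section ComplexModulus.
Variable R : realType.
Local Notation C := R[i].
Implicit Types x y z : C.

Lemma cabsE x : (cabs x)%:C%C = `|x|.
Proof. by []. Qed.

Lemma cabs_ge0 x : 0 <= cabs x.
Proof. by rewrite -ler0c cabsE normr_ge0. Qed.

Lemma cabs0 : cabs (0 : C) = 0.
Proof. exact: ComplexField.Normc.normc0. Qed.

Lemma cabs1 : cabs (1 : C) = 1.
Proof. exact: ComplexField.Normc.normc1. Qed.

Lemma cabsM x y : cabs (x * y) = cabs x * cabs y.
Proof. exact: ComplexField.Normc.normcM. Qed.

Lemma cabsX x n : cabs (x ^+ n) = cabs x ^+ n.
Proof. by elim: n => [|n IH]; rewrite ?expr0 ?cabs1 // !exprS cabsM IH. Qed.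

Lemma cabsN x : cabs (- x) = cabs x.
Proof. exact: (@normcN R). Qed.

Lemma cabsD x y : cabs (x + y) <= cabs x + cabs y.
Proof. exact: (@le_normcD R). Qed.

Lemma cabsB x y : cabs (x - y) <= cabs x + cabs y.
Proof. by rewrite -(cabsN y) cabsD. Qed.

Lemma cabs_subC x y : cabs (x - y) = cabs (y - x).
Proof. by rewrite -cabsN opprB. Qed.

Lemma cabs_sub_ge x y : cabs x - cabs y <= cabs (x - y).
Proof. by rewrite lerBlDr (le_trans _ (cabsD _ _)) ?subrK. Qed.

Lemma cabs_dist x y : `|cabs x - cabs y| <= cabs (x - y).
Proof.
rewrite ler_norml cabs_sub_ge andbT lerNl opprB cabs_subC.
exact: cabs_sub_ge.
Qed.

Lemma cabs_eq0 x : (cabs x == 0) = (x == 0).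
Proof.
apply/eqP/eqP => [|->]; last exact: cabs0.
exact: ComplexField.Normc.eq0_normc.
Qed.

Lemma cabs_gt0 x : (0 < cabs x) = (x != 0).
Proof. by rewrite lt_def cabs_eq0 cabs_ge0 andbT. Qed.

Lemma cabs_nat n : cabs (n%:R : C) = n%:R.
Proof.
have := normcMn (1 : Rcomplex R) n; rewrite /cabs => ->.
by rewrite ComplexField.Normc.normc1.
Qed.

Lemma cabs_prod (I : Type) (r : seq I) (F : I -> C) :
  cabs (\prod_(i <- r) F i) = \prod_(i <- r) cabs (F i).
Proof.
by elim/big_ind2: _ => [|x1 x2 y1 y2 <- <-|//]; rewrite ?cabs1 ?cabsM.
Qed.

Lemma cnorm_ge0 (v : C * C) : 0 <= cnorm v.
Proof. by rewrite le_max cabs_ge0. Qed.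

Lemma cnorm_ge1 (v : C * C) : cabs v.1 <= cnorm v.
Proof. by rewrite le_max lexx. Qed.

Lemma cnorm_ge2 (v : C * C) : cabs v.2 <= cnorm v.
Proof. by rewrite le_max lexx orbT. Qed.

End ComplexModulus.

(** * Duplication near a nodal fibre *)

Section DegenerationEstimate.
Variable R : realType.
Local Notation C := R[i].

(* Duplication on [y^2 = x (x - a) (x - b)] in the coordinate [x = v.1 / v.2]. *)
Definition dup (S : comNzRingType) (a b : S) (v : S * S) : S * S :=
  ((v.1 ^+ 2 - a * b * v.2 ^+ 2) ^+ 2,
   4%:R * v.1 * v.2 * (v.1 - a * v.2) * (v.1 - b * v.2)).

(* [gap a v / cnorm v ^+ 2] measures how far [v] is from the node [x = 0] of
   the degenerate fibre [a = 0]; the term in [|a|] is the scale below which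
   the fibre is no longer nodal. *)
Definition gap (a : C) (v : C * C) : R :=
  Num.max (cabs v.1 ^+ 2) (cabs a * cnorm v ^+ 2).

(* Below, [p = |A|], [q = |B|], [s = |a|], [X = |A^2 - a b B^2|],
   [Y = |A - a B|] and [Z = |A - b B|]; the last three hypotheses come from
   writing [(A + a B)(A - a B)], [(A + b B)(A - b B)] and [A^2] as
   [(A^2 - a b B^2)] plus a multiple of [B^2]. *)
Section Real.
Variables (m M s p q X Y Z : R).
Hypotheses (m0 : 0 < m) (m1 : m <= 1) (M1 : 1 <= M).
Hypotheses (s0 : 0 <= s) (sM : s <= M) (p0 : 0 <= p) (q0 : 0 <= q).
Hypotheses (X0 : 0 <= X) (Y0 : 0 <= Y) (Z0 : 0 <= Z).
Hypotheses (XU : X <= p ^+ 2 + s * M * q ^+ 2) (XL : p ^+ 2 - s * M * q ^+ 2 <= X).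
Hypotheses (YU : Y <= p + s * q) (ZU : Z <= p + M * q).
Hypotheses (YL : m * s * q ^+ 2 - X <= (p + s * q) * Y).
Hypotheses (ZL : m ^+ 2 * q ^+ 2 - X <= (p + M * q) * Z).
Hypotheses (PL : m * s * q ^+ 2 - X <= p ^+ 2).
Let N := Num.max p q.
Let N' := Num.max (X ^+ 2) (4 * p * q * Y * Z).
Let D := Num.max (p ^+ 2) (s * N ^+ 2).
Let D' := Num.max ((X ^+ 2) ^+ 2) (s * N' ^+ 2).

Local Ltac hyps := move: m0 m1 M1 s0 sM p0 q0 X0 Y0 Z0.
Let pN : p <= N. Proof. by rewrite le_max lexx. Qed.
Let qN : q <= N. Proof. by rewrite le_max lexx orbT. Qed.
Let N0 : 0 <= N. Proof. exact: le_trans pN. Qed.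
Let M0 : 0 < M. Proof. exact: lt_le_trans M1. Qed.

Lemma dup_upper : N' <= 64 * M ^+ 4 * N ^+ 4.
Proof using All.
have p2 : p ^+ 2 <= N ^+ 2 by rewrite ler_sqr ?nnegrE.
have q2 : q ^+ 2 <= N ^+ 2 by rewrite ler_sqr ?nnegrE.
have X2 : X <= 2 * M ^+ 2 * N ^+ 2.
  have : s * M * q ^+ 2 <= M * M * N ^+ 2.
    by rewrite ler_pM ?mulr_ge0 ?sqr_ge0 ?(ltW M0) // ler_pM ?(ltW M0).
  have : N ^+ 2 <= M ^+ 2 * N ^+ 2 by rewrite ler_peMl ?sqr_ge0 // exprn_ege1.
  by move: XU p2; lra.
have Y2 : Y <= 2 * M * N.
  have : s * q <= M * N by rewrite ler_pM.
  have : N <= M * N by rewrite ler_peMl.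
  by move: YU ZU pN; lra.
have Z2 : Z <= 2 * M * N.
  have : M * q <= M * N by rewrite ler_pM ?(ltW M0).
  have : N <= M * N by rewrite ler_peMl.
  by move: YU ZU pN; lra.
have M4 : 0 <= M ^+ 4 * N ^+ 4 by rewrite mulr_ge0 ?exprn_ge0 ?(ltW M0).
rewrite ge_max; apply/andP; split.
  have : X ^+ 2 <= (2 * M ^+ 2 * N ^+ 2) ^+ 2.
    by rewrite ler_sqr ?nnegrE // (le_trans X0 X2).
  hyps; lra.
have h1 : p * q <= N * N by rewrite ler_pM.
have h2 : Y * Z <= (2 * M * N) * (2 * M * N) by rewrite ler_pM.
have h3 : (p * q) * (Y * Z) <= (N * N) * ((2 * M * N) * (2 * M * N)).
  by rewrite ler_pM ?mulr_ge0.
have h4 : M ^+ 2 * N ^+ 4 <= M ^+ 4 * N ^+ 4.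
  by rewrite ler_wpM2r ?exprn_ge0 // ler_weXn2l.
hyps; lra.
Qed.

(** * Far from the node: [A^2] dominates [a b B^2] *)

Section Far.
Hypothesis far : 2 * M * s * q ^+ 2 <= p ^+ 2.

Let XL1 : p ^+ 2 / 2 <= X. Proof. by hyps; move: XL far; lra. Qed.

Let DU1 : D <= M * p ^+ 2.
Proof.
have h : p ^+ 2 <= M * p ^+ 2 by rewrite ler_peMl ?sqr_ge0.
rewrite ge_max h /= /N; case: (leP p q) => _.
  have : 0 <= s * q ^+ 2 by rewrite mulr_ge0 ?sqr_ge0.
  have : s * q ^+ 2 <= M * (s * q ^+ 2) by rewrite ler_peMl ?mulr_ge0 ?sqr_ge0.
  by move: far h (sqr_ge0 p); lra.
by rewrite ler_wpM2r ?sqr_ge0.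
Qed.

Let X4 : p ^+ 8 / 16 <= (X ^+ 2) ^+ 2.
Proof.
have e : p ^+ 8 / 16 = (p ^+ 2 / 2) ^+ 4 by field.
by rewrite e -exprM; apply: lerXn2r => //; rewrite nnegrE ?divr_ge0 ?sqr_ge0.
Qed.

(** The first coordinate suffices here: [X] is at least [p^2 / 2], while [D] is at most [M p^2]. *)
Lemma dup_lower_far : D ^+ 2 <= 4 * M ^+ 2 * N'.
Proof using All.
have h1 : D ^+ 2 <= (M * p ^+ 2) ^+ 2.
  by rewrite ler_sqr ?nnegrE ?mulr_ge0 ?sqr_ge0 ?(ltW M0) // le_max sqr_ge0.
have h2 : (p ^+ 2 / 2) ^+ 2 <= X ^+ 2 by rewrite ler_sqr ?nnegrE ?divr_ge0 ?sqr_ge0.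
have h3 : X ^+ 2 <= N' by rewrite le_max lexx.
apply: (le_trans h1).
have -> : (M * p ^+ 2) ^+ 2 = 4 * M ^+ 2 * (p ^+ 2 / 2) ^+ 2 by field.
by apply: ler_wpM2l (le_trans h2 h3); rewrite mulr_ge0 ?sqr_ge0.
Qed.

(** [D'] is bounded below by [X^4], which is of order [p^8]. The upper bound on [N'] has to gain a
    matching power of [p]: since [s q <= p], both [X] and [p Y] are at most [2 p^2]. *)
Lemma dup_gap_far : D ^+ 2 * N' ^+ 2 <= 2 ^+ 12 * M ^+ 4 * (D' * N ^+ 4).
Proof using All.
have sq : s * q <= p.
  rewrite -ler_sqr ?nnegrE ?mulr_ge0 // exprMn.
  have h1 : s * q ^+ 2 * s <= s * q ^+ 2 * (2 * M).
    by rewrite ler_wpM2l ?mulr_ge0 ?sqr_ge0 //; hyps; lra.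
  by hyps; move: far; lra.
have p2 : p ^+ 2 <= N ^+ 2 by rewrite ler_sqr ?nnegrE.
have XU1 : X <= 2 * p ^+ 2.
  have : s * M * q ^+ 2 <= 2 * M * s * q ^+ 2.
    by hyps; have := mulr_ge0 (mulr_ge0 s0 (ltW M0)) (sqr_ge0 q); lra.
  by hyps; move: far XU; lra.
have N'U : N' <= 16 * M * p ^+ 2 * N ^+ 2.
  have h0 : 0 <= p ^+ 2 * N ^+ 2 by rewrite mulr_ge0 ?sqr_ge0.
  have h0' : p ^+ 2 * N ^+ 2 <= M * (p ^+ 2 * N ^+ 2) by rewrite ler_peMl.
  rewrite ge_max; apply/andP; split.
    have : X * X <= (2 * p ^+ 2) * (2 * N ^+ 2).
      by rewrite ler_pM // (le_trans XU1) // ler_wpM2l.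
    hyps; lra.
  have Y1 : Y <= 2 * p by hyps; move: YU sq; lra.
  have Z1 : Z <= 2 * M * N.
    have : M * q <= M * N by rewrite ler_pM ?(ltW M0).
    have : N <= M * N by rewrite ler_peMl.
    by hyps; move: ZU pN; lra.
  have h1 : p * Y <= p * (2 * p) by rewrite ler_wpM2l.
  have h2 : q * Z <= N * (2 * M * N) by rewrite ler_pM.
  have h3 : (p * Y) * (q * Z) <= (p * (2 * p)) * (N * (2 * M * N)).
    by rewrite ler_pM ?mulr_ge0.
  hyps; lra.
have D2 : D ^+ 2 <= (M * p ^+ 2) ^+ 2.
  by rewrite ler_sqr ?nnegrE ?mulr_ge0 ?sqr_ge0 ?(ltW M0) // le_max sqr_ge0.
have N0' : 0 <= N' by rewrite le_max sqr_ge0.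
have N2 : N' ^+ 2 <= (16 * M * p ^+ 2 * N ^+ 2) ^+ 2.
  by rewrite ler_sqr ?nnegrE // (le_trans N0').
apply: (@le_trans _ _ ((M * p ^+ 2) ^+ 2 * (16 * M * p ^+ 2 * N ^+ 2) ^+ 2)).
  by rewrite ler_pM ?sqr_ge0.
have -> : (M * p ^+ 2) ^+ 2 * (16 * M * p ^+ 2 * N ^+ 2) ^+ 2 =
   2 ^+ 12 * M ^+ 4 * ((p ^+ 8 / 16) * N ^+ 4) by field.
apply: ler_wpM2l; first by rewrite mulr_ge0 ?exprn_ge0 ?(ltW M0).
by rewrite ler_wpM2r ?exprn_ge0 // (le_trans X4) // le_max lexx.
Qed.

End Far.

(** * Near the node: [p^2] is at most of the order of [s q^2] *)

Section Near.
Hypothesis near : p ^+ 2 <= 2 * M * s * q ^+ 2.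

Let q2N : q ^+ 2 <= N ^+ 2. Proof. by rewrite ler_sqr ?nnegrE. Qed.

Let DU1 : D <= 2 * M * s * N ^+ 2.
Proof.
rewrite ge_max; apply/andP; split.
  by rewrite (le_trans near) // ler_wpM2l ?mulr_ge0 ?(ltW M0).
by rewrite ler_wpM2r ?sqr_ge0 // ler_peMl //; hyps; lra.
Qed.

(** Now [D] is at most of order [s N^2], so the term [s N'^2] of [D'] is enough; the second factor
    [s] is absorbed by [s <= M]. *)
Lemma dup_gap_near : D ^+ 2 * N' ^+ 2 <= 4 * M ^+ 3 * (D' * N ^+ 4).
Proof using All.
have D2 : D ^+ 2 <= (2 * M * s * N ^+ 2) ^+ 2.
  rewrite ler_sqr ?nnegrE // ?le_max ?sqr_ge0 //.
  by rewrite !mulr_ge0 ?(ltW M0) ?sqr_ge0.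
apply: (@le_trans _ _ ((2 * M * s * N ^+ 2) ^+ 2 * N' ^+ 2)).
  by rewrite ler_wpM2r ?sqr_ge0.
have h : s * N' ^+ 2 <= D' by rewrite le_max lexx orbT.
have h1 : (s * (s * N' ^+ 2)) * N ^+ 4 <= M * D' * N ^+ 4.
  apply: ler_wpM2r; first exact: exprn_ge0.
  by apply: ler_pM => //; rewrite mulr_ge0 ?sqr_ge0.
have h2 := ler_wpM2l (_ : 0 <= 4 * M ^+ 2) h1.
have := h2 _; rewrite mulr_ge0 ?sqr_ge0 // => /(_ isT); lra.
Qed.

(** Either [X] is at least of the order of [s q^2] and [X^2] is large enough, or [A^2] is close to
    [a b B^2]. In the latter case [A / B] keeps away from the abscissas [0], [a] and [b] of the
    2-torsion, so the second coordinate is large. *)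
Lemma dup_lower_near : m ^+ 4 * D ^+ 2 <= 2 ^+ 10 * M ^+ 9 * N'.
Proof using All.
have Mn n : 1 <= M ^+ n by rewrite exprn_ege1.
have NM : N <= 2 * M * q.
  rewrite ge_max; apply/andP; split; last by rewrite ler_peMl //; hyps; lra.
  rewrite -ler_sqr ?nnegrE ?mulr_ge0 ?(ltW M0) // (le_trans near) //.
  have -> : (2 * M * q) ^+ 2 = 4 * (M * M * q ^+ 2) by ring.
  have : M * s * q ^+ 2 <= M * M * q ^+ 2.
    by rewrite ler_wpM2r ?sqr_ge0 // ler_wpM2l ?(ltW M0).
  by hyps; have := mulr_ge0 (mulr_ge0 (ltW M0) s0) (sqr_ge0 q); lra.
(* By [NM], [D] is at most of order [s q^2], so a bound on [s^2 q^4] remains. *)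
suff key : m ^+ 4 * (s ^+ 2 * q ^+ 4) <= 9 * M ^+ 3 * N'.
  have D2 : D ^+ 2 <= (2 * M * s * N ^+ 2) ^+ 2.
    rewrite ler_sqr ?nnegrE // ?le_max ?sqr_ge0 //.
    by rewrite !mulr_ge0 ?(ltW M0) ?sqr_ge0.
  have N4 : N ^+ 4 <= (2 * M * q) ^+ 4.
    by apply: lerXn2r; rewrite ?nnegrE ?mulr_ge0 ?(ltW M0).
  have h1 : (2 * M * s * N ^+ 2) ^+ 2 <= 4 * M ^+ 2 * s ^+ 2 * (2 * M * q) ^+ 4.
    have -> : (2 * M * s * N ^+ 2) ^+ 2 = 4 * M ^+ 2 * s ^+ 2 * N ^+ 4 by ring.
    apply: ler_wpM2l N4; rewrite (_ : _ * _ = (2 * M * s) ^+ 2) ?sqr_ge0 //.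
    by ring.
  have h2 : m ^+ 4 * D ^+ 2 <= 64 * M ^+ 6 * (m ^+ 4 * (s ^+ 2 * q ^+ 4)).
    apply: (@le_trans _ _ (m ^+ 4 * (4 * M ^+ 2 * s ^+ 2 * (2 * M * q) ^+ 4))).
      by rewrite ler_wpM2l ?exprn_ge0 ?(ltW m0) // (le_trans D2).
    by lra.
  apply: (le_trans h2).
  have h3 := ler_wpM2l (_ : 0 <= 64 * M ^+ 6) key.
  apply: (le_trans (h3 _)); first by rewrite mulr_ge0 ?exprn_ge0 ?(ltW M0).
  have : 0 <= M ^+ 9 * N'.
    by rewrite mulr_ge0 ?exprn_ge0 ?(ltW M0) // le_max sqr_ge0.
  by lra.
have sq2 : 0 <= s * q ^+ 2 by rewrite mulr_ge0 ?sqr_ge0.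
have X2N : X ^+ 2 <= N' by rewrite le_max lexx.
have BN : 4 * p * q * Y * Z <= N' by rewrite le_max lexx orbT.
have N0' : 0 <= N' by rewrite (le_trans _ X2N) ?sqr_ge0.
case: (leP (m ^+ 2 * (s * q ^+ 2)) (2 * M * X)) => hX.
  have h1 : (m ^+ 2 * (s * q ^+ 2)) ^+ 2 <= (2 * M * X) ^+ 2.
    rewrite ler_sqr ?nnegrE //; first exact: mulr_ge0 (sqr_ge0 _) sq2.
    by rewrite !mulr_ge0 ?(ltW M0).
  have -> : m ^+ 4 * (s ^+ 2 * q ^+ 4) = (m ^+ 2 * (s * q ^+ 2)) ^+ 2 by ring.
  apply: (le_trans h1); have -> : (2 * M * X) ^+ 2 = 4 * M ^+ 2 * X ^+ 2 by ring.
  have h2 : M ^+ 2 <= M ^+ 3 by rewrite ler_weXn2l.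
  have h3 : M ^+ 2 * X ^+ 2 <= M ^+ 3 * N' by rewrite ler_pM ?sqr_ge0.
  have : 0 <= M ^+ 3 * N' by rewrite mulr_ge0 ?exprn_ge0 ?(ltW M0).
  lra.
have mm : m ^+ 2 <= m by rewrite expr2 ler_piMl // ltW.
(* From here on [X] is at most half of the term from which it is subtracted in [YL], [PL] and
   [ZL]. *)
have hX1 : X <= m / 2 * (s * q ^+ 2).
  have : m ^+ 2 * (s * q ^+ 2) <= m * (s * q ^+ 2) by rewrite ler_wpM2r.
  have : X <= M * X by rewrite ler_peMl.
  by hyps; move: hX; lra.
have hX2 : X <= m ^+ 2 / 2 * q ^+ 2.
  have : m ^+ 2 * (s * q ^+ 2) <= m ^+ 2 * (M * q ^+ 2).
    by rewrite ler_wpM2l ?sqr_ge0 // ler_wpM2r ?sqr_ge0.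
  move=> h; rewrite -(ler_pM2l (_ : 0 < 2 * M)); last by rewrite mulr_gt0.
  by hyps; move: hX h; lra.
have [->|q1] := eqVneq q 0.
  by rewrite !expr0n /= !mulr0 !mulr_ge0 ?exprn_ge0 ?(ltW M0).
have qp : 0 < q by rewrite lt_def q1.
have Zl : m ^+ 2 * q <= 6 * M * Z.
  have h1 : m ^+ 2 / 2 * q ^+ 2 <= (p + M * q) * Z by hyps; move: ZL; lra.
  have h2 : p + M * q <= 3 * M * q.
    by hyps; have := le_trans pN NM; lra.
  have h3 : (p + M * q) * Z <= 3 * M * q * Z by rewrite ler_wpM2r.
  rewrite -(ler_pM2l qp); hyps; move: h1 h3; lra.
(* Makes [p + s q], the factor of [Y] in [YL], comparable with [p]. *)
have sqp : m * (s * q) <= 2 * M * p.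
  rewrite -ler_sqr ?nnegrE ?mulr_ge0 ?(ltW M0) ?(ltW m0) //.
  have h1 : m / 2 * (s * q ^+ 2) <= p ^+ 2 by hyps; move: PL hX1; lra.
  have h2 : m * s <= 1 * M by rewrite ler_pM ?(ltW m0).
  have h3 : (m * s) * (m / 2 * (s * q ^+ 2)) <= (1 * M) * p ^+ 2.
    by rewrite ler_pM ?mulr_ge0 ?divr_ge0 ?sqr_ge0 ?(ltW m0).
  have h4 : M * p ^+ 2 <= M * (M * p ^+ 2).
    by rewrite ler_peMl ?mulr_ge0 ?sqr_ge0 ?(ltW M0).
  have h5 : 0 <= M * p ^+ 2 by rewrite mulr_ge0 ?sqr_ge0 ?(ltW M0).
  hyps; lra.
have Yl : m ^+ 2 * (s * q ^+ 2) <= 6 * M * (p * Y).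
  have h1 : m / 2 * (s * q ^+ 2) <= (p + s * q) * Y by hyps; move: YL hX1; lra.
  have h2 : m * (p + s * q) <= 3 * M * p.
    have : m * p <= M * p by rewrite ler_wpM2r //; hyps; lra.
    hyps; lra.
  have h3 : m * (p + s * q) * Y <= 3 * M * p * Y by rewrite ler_wpM2r.
  have h4 := ler_wpM2l (ltW m0) h1.
  hyps; move: h3 h4; lra.
have h : (m ^+ 2 * (s * q ^+ 2)) * (m ^+ 2 * q) <= (6 * M * (p * Y)) * (6 * M * Z).
  apply: ler_pM Yl Zl; first exact: mulr_ge0 (sqr_ge0 _) sq2.
  exact: mulr_ge0 (sqr_ge0 _) q0.
have h' := ler_wpM2l q0 h.
have h6 : m ^+ 4 * (s * q ^+ 4) <= 9 * M ^+ 2 * N'.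
  apply: (@le_trans _ _ (9 * M ^+ 2 * (4 * p * q * Y * Z))).
    by hyps; move: h'; lra.
  by rewrite ler_wpM2l // mulr_ge0 ?sqr_ge0.
have h7 : s * (m ^+ 4 * (s * q ^+ 4)) <= M * (9 * M ^+ 2 * N').
  by rewrite ler_pM // !mulr_ge0 ?exprn_ge0 ?(ltW m0).
by hyps; move: h7; lra.
Qed.

End Near.
End Real.

(** In terms of [r = gap a v / cnorm v ^+ 2] the last bound reads [r' >= c r^2]. The constant
    depends on [m] and [M] only, so the estimates are uniform as [a] tends to [0] and include
    [a = 0]. *)
Lemma dup_estimate (m M : R) : 0 < m -> m <= 1 -> 1 <= M ->
  exists2 c : R, 0 < c & forall (a b : C) v, cabs a <= M -> cabs b <= M ->
    m <= cabs b -> m <= cabs (a - b) ->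
    [/\ c * cnorm (dup a b v) <= cnorm v ^+ 4,
        c * gap a v ^+ 2 <= cnorm (dup a b v) &
        c * (gap a v ^+ 2 * cnorm (dup a b v) ^+ 2)
          <= gap a (dup a b v) * cnorm v ^+ 4].
Proof.
move=> m0 m1 M1; have M0 : 0 < M by exact: lt_le_trans M1.
(* The powers of [m] and [M] come from [dup_lower_near], the factor [2 ^+ 12] from [dup_gap_far]. *)
exists (m ^+ 4 / (2 ^+ 12 * M ^+ 9)) => [|a b [A B] aM bM mb mab].
  by rewrite divr_gt0 ?mulr_gt0 ?exprn_gt0 ?ltr0n.
have m4 : 0 < m ^+ 4 by rewrite exprn_gt0.
have m4' : m ^+ 4 <= 1 by rewrite exprn_ile1 // ltW.
have Mn n : 0 < M ^+ n by rewrite exprn_gt0.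
have Ml n k : (n <= k)%N -> M ^+ n <= M ^+ k by move=> nk; rewrite ler_weXn2l.
(* Weakens a bound with its own constants [x] and [K] to one with the common constant. *)
have cl (x y u K : R) : 0 <= y -> 0 <= u -> m ^+ 4 <= x -> K <= 2 ^+ 12 * M ^+ 9 ->
    x * y <= K * u -> m ^+ 4 / (2 ^+ 12 * M ^+ 9) * y <= u.
  move=> y0 u0 xm hK h; rewrite mulrAC ler_pdivrMr ?mulr_gt0 //.
  rewrite (le_trans (ler_wpM2r y0 xm)) // (le_trans h) // mulrC.
  by rewrite ler_wpM2l.
pose p := cabs A; pose q := cabs B; pose s := cabs a.
pose X := cabs (A ^+ 2 - a * b * B ^+ 2).
pose Y := cabs (A - a * B); pose Z := cabs (A - b * B).
have [p0 q0 s0] : [/\ 0 <= p, 0 <= q & 0 <= s] by rewrite !cabs_ge0.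
have [X0 Y0 Z0] : [/\ 0 <= X, 0 <= Y & 0 <= Z] by rewrite !cabs_ge0.
have abM : s * cabs b * q ^+ 2 <= s * M * q ^+ 2.
  by rewrite ler_wpM2r ?sqr_ge0 // ler_wpM2l.
have XU : X <= p ^+ 2 + s * M * q ^+ 2.
  by rewrite (le_trans (cabsB _ _)) // cabsX 2!cabsM cabsX lerD2l.
have XL : p ^+ 2 - s * M * q ^+ 2 <= X.
  by rewrite (le_trans _ (cabs_sub_ge _ _)) // cabsX 2!cabsM cabsX lerD2l lerN2.
have YU : Y <= p + s * q by rewrite (le_trans (cabsB _ _)) // cabsM.
have ZU : Z <= p + M * q.
  by rewrite (le_trans (cabsB _ _)) // cabsM lerD2l ler_wpM2r.
have low (u : C) k : k <= cabs u -> k - X <= cabs (u + (A ^+ 2 - a * b * B ^+ 2)).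
  move=> ku; have := cabs_sub_ge u (- (A ^+ 2 - a * b * B ^+ 2)).
  by rewrite opprK cabsN; apply: le_trans; rewrite lerD2r.
have mq : 0 <= m * q ^+ 2 by rewrite mulr_ge0 ?sqr_ge0 ?ltW.
have YL : m * s * q ^+ 2 - X <= (p + s * q) * Y.
  apply: (@le_trans _ _ (cabs (A + a * B) * Y)).
    rewrite -cabsM (_ : _ * _ = a * (b - a) * B ^+ 2 + (A ^+ 2 - a * b * B ^+ 2));
      last by ring.
    apply: low => //; rewrite 2!cabsM cabsX cabs_subC (mulrC m).
    by rewrite ler_wpM2r ?sqr_ge0 // ler_wpM2l.
  by rewrite ler_wpM2r // (le_trans (cabsD _ _)) // cabsM.
have ZL : m ^+ 2 * q ^+ 2 - X <= (p + M * q) * Z.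
  apply: (@le_trans _ _ (cabs (A + b * B) * Z)).
    rewrite -cabsM (_ : _ * _ = b * (a - b) * B ^+ 2 + (A ^+ 2 - a * b * B ^+ 2));
      last by ring.
    apply: low => //; rewrite 2!cabsM cabsX.
    by rewrite ler_wpM2r ?sqr_ge0 // expr2 ler_pM // ltW.
  by rewrite ler_wpM2r // (le_trans (cabsD _ _)) // cabsM lerD2l ler_wpM2r.
have PL : m * s * q ^+ 2 - X <= p ^+ 2.
  rewrite /p -cabsX (_ : A ^+ 2 = a * b * B ^+ 2 + (A ^+ 2 - a * b * B ^+ 2));
    last by ring.
  apply: low => //; rewrite 2!cabsM cabsX (mulrC m).
  by rewrite ler_wpM2r ?sqr_ge0 // ler_wpM2l.
have eN : cnorm (dup a b (A, B)) = Num.max (X ^+ 2) (4 * p * q * Y * Z).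
  by rewrite /cnorm /= cabsX 4!cabsM cabs_nat.
have eG : gap a (dup a b (A, B)) =
    Num.max ((X ^+ 2) ^+ 2) (s * Num.max (X ^+ 2) (4 * p * q * Y * Z) ^+ 2).
  by rewrite /gap eN /= cabsX.
have N4 : 0 <= Num.max p q ^+ 4 by rewrite exprn_ge0 // le_max p0.
have N'0 : 0 <= Num.max (X ^+ 2) (4 * p * q * Y * Z) by rewrite le_max sqr_ge0.
have big n : (n <= 9)%N -> forall k : R, 0 <= k -> k <= 2 ^+ 12 ->
    k * M ^+ n <= 2 ^+ 12 * M ^+ 9.
  by move=> n9 k k0 k4; rewrite ler_pM ?Ml // ltW.
have kle k n : (n <= 12)%N -> (k <= 2 ^ n)%N -> (k%:R : R) <= 2 ^+ 12.
  move=> n12 kn; rewrite -natrX ler_nat (leq_trans kn) //.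
  by rewrite leq_exp2l.
rewrite eN eG /gap /cnorm /= -/p -/q -/s; split.
- apply: (@cl 1 _ _ (64 * M ^+ 4)) => //.
    by apply: big => //; exact: (@kle 64 6).
  by rewrite mul1r; exact: (dup_upper m0 m1 M1 s0 aM p0 q0 X0 Y0 Z0 XU XL YU ZU YL ZL PL).
- case: (leP (2 * M * s * q ^+ 2) (p ^+ 2)) => [far|/ltW near].
    apply: (@cl 1 _ _ (4 * M ^+ 2)); rewrite ?sqr_ge0 ?mul1r //.
      by apply: big => //; exact: (@kle 4 2).
    exact: (dup_lower_far m0 m1).
  apply: (@cl (m ^+ 4) _ _ (2 ^+ 10 * M ^+ 9)); rewrite ?sqr_ge0 //.
    by apply: big => //; rewrite ?exprn_ge0 // ler_weXn2l // ler1n.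
  exact: (dup_lower_near m0 m1).
- have h0 : 0 <= Num.max ((X ^+ 2) ^+ 2)
      (s * Num.max (X ^+ 2) (4 * p * q * Y * Z) ^+ 2) by rewrite le_max sqr_ge0.
  have h1 : 0 <= Num.max ((X ^+ 2) ^+ 2)
      (s * Num.max (X ^+ 2) (4 * p * q * Y * Z) ^+ 2) * Num.max p q ^+ 4.
    exact: mulr_ge0.
  have h2 : 0 <= Num.max (p ^+ 2) (s * Num.max p q ^+ 2) ^+ 2 *
      Num.max (X ^+ 2) (4 * p * q * Y * Z) ^+ 2 by rewrite mulr_ge0 ?sqr_ge0.
  case: (leP (2 * M * s * q ^+ 2) (p ^+ 2)) => [far|/ltW near].
    apply: (@cl 1 _ _ (2 ^+ 12 * M ^+ 4)) => //.
      by apply: big => //; rewrite exprn_ge0.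
    by rewrite mul1r; exact: (dup_gap_far m0 m1).
  apply: (@cl 1 _ _ (4 * M ^+ 3)) => //.
    by apply: big => //; exact: (@kle 4 2).
  by rewrite mul1r; exact: (dup_gap_near m0 m1).
Qed.

End DegenerationEstimate.

(** * Bihomogeneous forms and the first iterate *)

Section BihomogeneousForms.
Variable R : realType.
Local Notation C := R[i].
Implicit Types (P Q g : bipoly R).

Lemma homogD P Q d : homog P d -> homog Q d -> homog (P + Q) d.
Proof.
move=> hP hQ i j; rewrite !coefD => h.
have [/eqP e|/hP//] := boolP ((P`_j)`_i == 0).
by apply: hQ; move: h; rewrite e add0r.
Qed.

Lemma homogN P d : homog P d -> homog (- P) d.
Proof. by move=> hP i j; rewrite !coefN oppr_eq0; exact: hP. Qed.

Lemma homogM P Q d e : homog P d -> homog Q e -> homog (P * Q) (d + e).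
Proof.
move=> hP hQ i j; apply: contraNeq => de.
rewrite coefM coef_sum big1 ?eqxx // => k _; rewrite coefM big1 // => l _.
apply/eqP; apply: contraNT de; rewrite mulf_eq0 => /norP[/hP <- /hQ <-].
apply/eqP; have := ltn_ord k; have := ltn_ord l; lia.
Qed.

Lemma homogX P d n : homog P d -> homog (P ^+ n) (n * d).
Proof.
move=> hP; elim: n => [|n IH].
  move=> i j; rewrite expr0 coef1; case: j => [|j] /=; last by rewrite coef0 eqxx.
  by rewrite coef1; case: i => [|i]; rewrite //= eqxx.
by rewrite exprS mulSn; apply: homogM.
Qed.

Lemma homog_t1 : homog (t1 R) 1.
Proof.
move=> i j; rewrite coefC; case: j => [|j] /=; last by rewrite coef0 eqxx.
by rewrite coefX addn0; case: (i =P 1%N) => [->//|_]; rewrite eqxx.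
Qed.

Lemma homog_t2 : homog (t2 R) 1.
Proof.
move=> i j; rewrite coefX; case: (j =P 1%N) => [->|_] /=; last by rewrite coef0 eqxx.
by rewrite coef1; case: i => [|i]; rewrite //= eqxx.
Qed.

Lemma homog_nat n : homog (n%:R : bipoly R) 0.
Proof.
move=> i j; rewrite -polyC_natr coefC; case: j => [|j] /=; last by rewrite coef0 eqxx.
by rewrite -polyC_natr coefC; case: i => [|i]; rewrite //= eqxx.
Qed.

(** Gives the degree left after the division by [t2^2] in the recursion. *)
Lemma homog_mult2 P d n : homog (t2 R ^+ n * P) (n + d) -> homog P d.
Proof.
move=> h i j hij; have := h i (n + j)%N.
rewrite coefXnM ltnNge leq_addr /= addKn => /(_ hij); lia.
Qed.

Lemma homog_coef P d j : homog P d ->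
  P`_j = (if (j <= d)%N then (P`_j)`_(d - j) *: 'X^(d - j) else 0).
Proof.
move=> hP; apply/polyP => i; case: ifP => jd.
  rewrite coefZ coefXn; case: eqP => [->|ne]; first by rewrite mulr1.
  rewrite mulr0; apply/eqP; apply: contra_notT ne => /hP; lia.
rewrite coef0; apply/eqP; apply: contraFT jd => /hP; lia.
Qed.

(** Pull-back along the arc [s |-> (u(s), v(s))]. Orders of vanishing along a line become powers of
    ['X] on an arc that crosses it at [s = 0]. *)
Definition subst (u v : {poly C}) : bipoly R -> {poly C} :=
  horner_eval v \o map_poly (comp_poly u).

HB.instance Definition _ u v := GRing.RMorphism.on (subst u v).

(** The same function as [ev], written as a composite so as to be a ring morphism. *)
Definition evm (x : C * C) : bipoly R -> C :=
  horner_eval x.2 \o map_poly (horner_eval x.1).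

HB.instance Definition _ x := GRing.RMorphism.on (evm x).

Lemma evE P x : ev P x = evm x P.
Proof. by []. Qed.

Lemma substC u v q : subst u v q%:P = q \Po u.
Proof. by rewrite /subst /= map_polyC /= /horner_eval hornerC. Qed.

Lemma evmC x q : evm x q%:P = q.[x.1].
Proof. by rewrite /evm /= map_polyC /= /horner_eval hornerC. Qed.

Lemma subst_t1 u v : subst u v (t1 R) = u.
Proof. by rewrite substC comp_polyX. Qed.

Lemma subst_t2 u v : subst u v (t2 R) = v.
Proof. by rewrite /subst /= map_polyX /horner_eval hornerX. Qed.

Lemma evm_t1 x : evm x (t1 R) = x.1.
Proof. by rewrite evmC hornerX. Qed.

Lemma evm_t2 x : evm x (t2 R) = x.2.
Proof. by rewrite /evm /= map_polyX /horner_eval hornerX. Qed.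

Lemma horner_subst u v P s : (subst u v P).[s] = evm (u.[s], v.[s]) P.
Proof.
elim/poly_ind: P => [|P c IH]; first by rewrite !rmorph0 horner0.
rewrite !rmorphD !rmorphM /= substC evmC hornerD hornerM IH horner_comp.
by rewrite -/(t2 R) subst_t2 evm_t2.
Qed.

Lemma evm_coef x P : evm x P = \sum_(j < size P) (P`_j).[x.1] * x.2 ^+ j.
Proof.
rewrite -{1}[P]coefK poly_def rmorph_sum; apply: eq_bigr => j _.
by rewrite -mul_polyC rmorphM rmorphXn /= evmC -/(t2 R) evm_t2.
Qed.

Lemma evm_homog P d k x : homog P d ->
  evm (k * x.1, k * x.2) P = k ^+ d * evm x P.
Proof.
move=> hP; rewrite !evm_coef mulr_sumr; apply: eq_bigr => j _ /=.
rewrite (homog_coef j hP); case: ifP => jd; last by rewrite !horner0 !mul0r mulr0.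
rewrite !hornerZ !hornerXn !exprMn.
have -> : k ^+ d = k ^+ (d - j) * k ^+ j by rewrite -exprD subnK.
ring.
Qed.

(** This is the restriction to the line [t2 = l t1], on which each monomial of degree [d] is a
    multiple of [t1^d]. *)
Lemma homog_line P d l : homog P d ->
  P.[l *: 'X] = evm (1, l) P *: 'X^d.
Proof.
move=> hP; rewrite evm_coef horner_coef scaler_suml; apply: eq_bigr => j _ /=.
rewrite (homog_coef j hP); case: ifP => jd; last by rewrite !horner0 !mul0r scale0r.
rewrite hornerZ hornerXn expr1n mulr1 exprZn -scalerAl -scalerAr scalerA.
by rewrite -exprD subnK.
Qed.

Lemma homog_zero_dvd P d l : homog P d -> evm (1, l) P = 0 ->
  bdvd ('X - (l *: 'X)%:P) P.
Proof.
move=> hP e; have : root P (l *: 'X) by rewrite /root (homog_line l hP) e scale0r.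
by move/factor_theorem.
Qed.

(** The line [t1 = 0] is not of the form [t2 = l t1], so divisibility by [t1] is checked on each
    coefficient in [t2]. By homogeneity only the coefficient of [t2^d] could be nonzero at [t1 = 0],
    and it is the value at [(0, 1)]. *)
Lemma homog_zero_dvd_t1 P d : homog P d -> evm (0, 1) P = 0 -> bdvd (t1 R) P.
Proof.
move=> hP e.
have P0 j : root P`_j 0.
  rewrite /root horner_coef0; have [//|nz] := boolP ((P`_j)`_0 == 0).
  move: e; rewrite evm_coef => e; have jd := hP _ _ nz; rewrite add0n in jd.
  have js : (j < size P)%N.
    rewrite ltnNge; apply: contra nz => js.
    by have -> : P`_j = 0 by [exact: nth_default]; rewrite coef0.
  case/eqP: nz; rewrite -[RHS]e (bigD1 (Ordinal js)) //= big1 ?addr0 ?horner_coef0 ?expr1n ?mulr1 //.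
  move=> k; rewrite -val_eqE /= => kj.
  rewrite horner_coef0 expr1n mulr1; apply/eqP; apply: contraNT kj => /hP.
  by rewrite add0n jd => ->.
exists (\poly_(j < size P) (P`_j %/ 'X)); apply/polyP => j.
rewrite coefMC coef_poly; case: ltnP => js; last by rewrite nth_default ?mul0r.
by rewrite divpK // -['X]subr0 dvdp_XsubCl P0.
Qed.

(** By homogeneity a common zero spreads to a line through the origin, whose equation is then a
    nonconstant common factor. *)
Lemma no_common_zero P Q d e x : homog P d -> homog Q e ->
  no_common_factor P Q -> punct x -> ~ (evm x P = 0 /\ evm x Q = 0).
Proof.
case: x => x1 x2 hP hQ nc px [zP zQ].
have sc F f k y : homog F f -> k != 0 -> evm (k * y.1, k * y.2) F = 0 -> evm y F = 0.
  move=> hF k0; rewrite (evm_homog _ _ hF) => /eqP.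
  by rewrite mulf_eq0 expf_eq0 (negPf k0) andbF => /eqP.
have [x10|x10] := eqVneq x1 0.
  have x20 : x2 != 0 by apply: contra_notN px => /eqP ->; rewrite x10.
  have zero F f : homog F f -> evm (x1, x2) F = 0 -> evm (0, 1) F = 0.
    rewrite x10 => hF z; apply: (sc _ _ x2 _ hF x20) => /=.
    by rewrite mulr0 mulr1.
  have [a [_ ga]] := nc _ (homog_zero_dvd_t1 hP (zero _ _ hP zP))
                        (homog_zero_dvd_t1 hQ (zero _ _ hQ zQ)).
  have := congr1 (fun p : bipoly R => (p`_0)`_1) ga.
  rewrite /t1 /= !coefC /= coefX /= => /eqP; by rewrite oner_eq0.
have zero F f : homog F f -> evm (x1, x2) F = 0 -> evm (1, x2 / x1) F = 0.
  move=> hF z; apply: (sc _ _ x1 _ hF x10) => /=.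
  by rewrite mulr1 mulrC divfK.
have [a [_ ga]] := nc _ (homog_zero_dvd hP (zero _ _ hP zP))
                      (homog_zero_dvd hQ (zero _ _ hQ zQ)).
have := congr1 (fun p : bipoly R => p`_1) ga.
rewrite /= coefB coefX !coefC /= subr0 => /eqP; by rewrite oner_eq0.
Qed.

Lemma homog_t2_dvd P d : homog P d -> evm (1, 0) P = 0 ->
  exists B, P = t2 R * B.
Proof.
move=> hP e; have [B ->] := homog_zero_dvd hP e.
by exists B; rewrite scale0r subr0 mulrC.
Qed.

Lemma subst_Fmap u v (F : bipoly R * bipoly R) :
  let z := subst u v F.1 in let w := subst u v F.2 in
  subst u v (Fmap F).1 = (u * w ^+ 2 - v * z ^+ 2) ^+ 2 /\
  subst u v (Fmap F).2 = 4%:R * v * z * w * (w - z) * (u * w - v * z).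
Proof.
rewrite /Fmap /=; split.
  by rewrite !expr2 !(rmorphM, rmorphB) /= subst_t1 subst_t2.
by rewrite !(rmorphM, rmorphB) /= rmorph_nat subst_t1 subst_t2.
Qed.

(* As [p] and [q] do not vanish together at [0], the [k]-fold zero of [g * p]
   and [g * q] must come from [g]. *)
Lemma cancel_zero k (g p q a b : {poly C}) :
  g * p = 'X^k * a -> g * q = 'X^k * b -> a.[0] != 0 ->
  ~ (p.[0] = 0 /\ q.[0] = 0) -> p.[0] != 0 /\ (b.[0] = 0 -> q.[0] = 0).
Proof.
move=> + + a0 pq; elim: k g => [|k IH] g.
  rewrite expr0 !mul1r => /(congr1 (horner^~ 0)) + /(congr1 (horner^~ 0)).
  rewrite /= !hornerM => ea eb; move: a0; rewrite -ea mulf_eq0 negb_or => /andP[g0 p0].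
  split=> // /eqP; rewrite -eb mulf_eq0 (negPf g0) => /eqP.
  by [].
move=> ea eb.
have g0 : root g 0.
  have [//|ng] := boolP (root g 0); case: pq; split; apply/eqP.
    have := congr1 (horner^~ 0) ea; rewrite /= !hornerE expr0n /= mul0r => /eqP.
    by rewrite mulf_eq0 -/(root g 0) (negPf ng).
  have := congr1 (horner^~ 0) eb; rewrite /= !hornerE expr0n /= mul0r => /eqP.
  by rewrite mulf_eq0 -/(root g 0) (negPf ng).
have [h eg] := factor_theorem _ _ g0; rewrite subr0 in eg.
have X0 := polyX_eq0 C.
by apply: (IH h); apply: (mulfI (negbT X0)); rewrite !mulrA -exprS -?ea -?eb eg; ring.
Qed.

(** * Orders of vanishing of [F_1] along the three degenerate lines *)

Section FirstIterate.
Variables (c1 c2 g P1 Q1 : bipoly R).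
Hypothesis nzc : forall x, punct x -> ~ (evm x c1 = 0 /\ evm x c2 = 0).
Hypothesis nz1 : forall x, punct x -> ~ (evm x P1 = 0 /\ evm x Q1 = 0).
Hypothesis eP : (Fmap (c1, c2)).1 = g * P1.
Hypothesis eQ : (Fmap (c1, c2)).2 = g * Q1.
Variable t : C.
Hypothesis t0 : t != 0.

Let zero_factor (p : {poly C}) : p.[0] = 0 -> exists e, p = 'X * e.
Proof.
move=> /eqP/factor_theorem[e ->]; by exists e; rewrite subr0 mulrC.
Qed.

Let split2 (p q : {poly C}) : ~ (p.[0] = 0 /\ q.[0] = 0) ->
  p.[0] != 0 \/ exists2 e, p = 'X * e & q.[0] != 0.
Proof.
have [/zero_factor[e ->]|] := eqVneq p.[0] 0; last by left.
move=> h; right; exists e => //; apply/eqP => q0; apply: h.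
by rewrite hornerM hornerX mul0r.
Qed.

Let nz_subst (F G : bipoly R) (u v : {poly C}) :
  (forall x, punct x -> ~ (evm x F = 0 /\ evm x G = 0)) ->
  punct (u.[0], v.[0]) -> ~ ((subst u v F).[0] = 0 /\ (subst u v G).[0] = 0).
Proof. by rewrite !horner_subst => h; exact: h. Qed.

(** On the arc [(s, t)], let [z] and [w] be the restrictions of [c1] and [c2]. If [z] is nonzero at
    [s = 0], so is the first component of [F(z, w)]. Otherwise both components are divisible by
    [s^2], the first one exactly, and by [cancel_zero] this power belongs to [g]. *)
Lemma first_iterate_t1_axis : evm (0, t) P1 != 0.
Proof using All.
have [u uX] : {u : {poly C} | u = 'X} by exists 'X.
have [v vt] : {v : {poly C} | v = t%:P} by exists t%:P.
have u0 : u.[0] = 0 by rewrite uX hornerX.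
have v0 : v.[0] = t by rewrite vt hornerC.
have px : punct (u.[0], v.[0]).
  by rewrite u0 v0 => -[e]; move: t0; rewrite e eqxx.
have := subst_Fmap u v (c1, c2); rewrite eP eQ !rmorphM /= => -[].
move: (nz_subst nzc px) (nz_subst nz1 px).
have -> F : evm (0, t) F = (subst u v F).[0] by rewrite horner_subst u0 v0.
move: (subst u v c1) (subst u v c2) (subst u v g) (subst u v P1) (subst u v Q1).
move=> z w h p q /split2[z0|[e -> w0]] pq ep eq.
  apply: (cancel_zero (k := 0) (g := h) (a := (u * w ^+ 2 - v * z ^+ 2) ^+ 2) _ _ _ pq).1.
  - by rewrite ep expr0 mul1r.
  - by rewrite eq expr0 mul1r.
  - have -> : ((u * w ^+ 2 - v * z ^+ 2) ^+ 2).[0] = (t * z.[0] ^+ 2) ^+ 2.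
      by rewrite !(hornerD, hornerN, hornerM, horner_exp) u0 v0; ring.
    by rewrite expf_neq0 // mulf_neq0 // expf_neq0.
apply: (cancel_zero (k := 2) (g := h) (a := (w ^+ 2 - v * u * e ^+ 2) ^+ 2)
  (b := 4%:R * v * e * w * (w - u * e) * (w - v * e)) _ _ _ pq).1.
- by rewrite ep uX; ring.
- by rewrite eq uX; ring.
- have -> : ((w ^+ 2 - v * u * e ^+ 2) ^+ 2).[0] = (w.[0] ^+ 2) ^+ 2.
    by rewrite !(hornerD, hornerN, hornerM, horner_exp) u0; ring.
  by rewrite !expf_neq0.
Qed.

(** The same argument on the arc [(t, s)], with the roles of [z] and [w] exchanged. In both cases
    the second component keeps a factor [s] after the common power is removed, whence the zero of
    [Q1]. *)
Lemma first_iterate_t2_axis : evm (t, 0) P1 != 0 /\ evm (t, 0) Q1 = 0.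
Proof using All.
have [u ut] : {u : {poly C} | u = t%:P} by exists t%:P.
have [v vX] : {v : {poly C} | v = 'X} by exists 'X.
have u0 : u.[0] = t by rewrite ut hornerC.
have v0 : v.[0] = 0 by rewrite vX hornerX.
have px : punct (u.[0], v.[0]).
  by rewrite u0 v0 => -[e]; move: t0; rewrite e eqxx.
have := subst_Fmap u v (c1, c2); rewrite eP eQ !rmorphM /= => -[].
have -> F : evm (t, 0) F = (subst u v F).[0] by rewrite horner_subst u0 v0.
have -> F : evm (t, 0) F = (subst u v F).[0] by rewrite horner_subst u0 v0.
move: (nz_subst nzc px) (nz_subst nz1 px).
move: (subst u v c1) (subst u v c2) (subst u v g) (subst u v P1) (subst u v Q1).
move=> z w h p q zw pq ep eq.
have /split2[w0|[e we z0]] : ~ (w.[0] = 0 /\ z.[0] = 0) by move=> [? ?]; apply: zw.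
  have [|||p0 q0] := cancel_zero (k := 0) (g := h)
    (a := (u * w ^+ 2 - v * z ^+ 2) ^+ 2)
    (b := 4%:R * v * z * w * (w - z) * (u * w - v * z)) _ _ _ pq.
  - by rewrite ep expr0 mul1r.
  - by rewrite eq expr0 mul1r.
  - have -> : ((u * w ^+ 2 - v * z ^+ 2) ^+ 2).[0] = (t * w.[0] ^+ 2) ^+ 2.
      by rewrite !(hornerD, hornerN, hornerM, horner_exp) u0 v0; ring.
    by rewrite expf_neq0 // mulf_neq0 // expf_neq0.
  - split=> //; apply: q0; by rewrite !(hornerD, hornerN, hornerM, horner_exp) v0; ring.
have [|||p0 q0] := cancel_zero (k := 2) (g := h) (a := (u * v * e ^+ 2 - z ^+ 2) ^+ 2)
  (b := 4%:R * v * z * e * (w - z) * (u * e - z)) _ _ _ pq.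
- by rewrite ep we vX; ring.
- by rewrite eq we vX; ring.
- have -> : ((u * v * e ^+ 2 - z ^+ 2) ^+ 2).[0] = (z.[0] ^+ 2) ^+ 2.
    by rewrite !(hornerD, hornerN, hornerM, horner_exp) v0; ring.
  by rewrite !expf_neq0.
- split=> //; apply: q0; by rewrite !(hornerD, hornerN, hornerM, horner_exp) v0; ring.
Qed.

(** The node of the fibre over [t1 = t2] is [x = t1], which in terms of [F_1 = (A, t2 B)] means
    [P1 = Q1]. So [t2 P1 - t1 Q1] takes the place of [P1], on the arc [(t + s, t)]. *)
Lemma first_iterate_diagonal : evm (t, t) P1 != evm (t, t) Q1.
Proof using All.
have [s sX] : {s : {poly C} | s = 'X} by exists 'X.
have [v vt] : {v : {poly C} | v = t%:P} by exists t%:P.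
have [u us] : {u : {poly C} | u = s + v} by exists (s + v).
have s0 : s.[0] = 0 by rewrite sX hornerX.
have v0 : v.[0] = t by rewrite vt hornerC.
have u0 : u.[0] = t by rewrite us hornerD s0 v0 add0r.
have px : punct (u.[0], v.[0]).
  by rewrite u0 v0 => -[e]; move: t0; rewrite e eqxx.
have := subst_Fmap u v (c1, c2); rewrite eP eQ !rmorphM /= => -[].
have -> F : evm (t, t) F = (subst u v F).[0] by rewrite horner_subst u0 v0.
have -> F : evm (t, t) F = (subst u v F).[0] by rewrite horner_subst u0 v0.
move: (nz_subst nzc px) (nz_subst nz1 px).
move: (subst u v c1) (subst u v c2) (subst u v g) (subst u v P1) (subst u v Q1).
move=> z w h p q zw pq ep eq.
have n0 : (v * p - u * q).[0] = t * (p.[0] - q.[0]).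
  by rewrite !(hornerD, hornerN, hornerM, horner_exp) u0 v0; ring.
have nq : ~ ((v * p - u * q).[0] = 0 /\ q.[0] = 0).
  move=> [+ q0]; rewrite n0 q0 subr0 => /eqP.
  by rewrite mulf_eq0 (negPf t0) => /eqP p0; apply: pq.
suff : (v * p - u * q).[0] != 0.
  by apply: contra => /eqP pq0; rewrite n0 pq0 subrr mulr0.
(* On the curve, the abscissa of a double minus that of a 2-torsion point is a square; this is the
   case of the point [x = t1], cleared of denominators. *)
have eN : h * (v * p - u * q) = v * (v * z ^+ 2 - 2%:R * u * z * w + u * w ^+ 2) ^+ 2.
  by rewrite mulrBr mulrCA ep [h * _]mulrCA eq; ring.
(* At [s = 0] the squared factor is [t (z - w)^2], so a power of [s] has to be removed only if
   [z = w] there. *)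
have [/zero_factor[e ze]|d0] := eqVneq (z - w).[0] 0; last first.
  apply: (cancel_zero (k := 0) (g := h) _ _ _ nq).1.
  - by rewrite eN expr0 mul1r.
  - by rewrite eq expr0 mul1r.
  rewrite (_ : _ - _ + _ = v * (z - w) ^+ 2 - s * w * (z + z - w)); last first.
    by rewrite us; ring.
  set d := z - w in d0 *.
  have -> : (v * (v * d ^+ 2 - s * w * (z + z - w)) ^+ 2).[0]
      = t * (t * d.[0] ^+ 2) ^+ 2.
    by rewrite !(hornerD, hornerN, hornerM, horner_exp) s0 v0; ring.
  by rewrite mulf_neq0 // expf_neq0 // mulf_neq0 // expf_neq0.
have zE : z = w + s * e by rewrite sX -ze; ring.
have w0 : w.[0] != 0.
  apply/eqP => w0; apply: zw; split=> //.
  by rewrite zE hornerD hornerM s0 w0 mul0r addr0.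
apply: (cancel_zero (k := 2) (g := h) (a := v * (v * s * e ^+ 2 - w * (z + z - w)) ^+ 2)
  (b := - (4%:R * v * z * w * e * (w - v * e))) _ _ _ nq).1.
- by rewrite eN zE us sX; ring.
- by rewrite eq zE us sX; ring.
- have -> : (v * (v * s * e ^+ 2 - w * (z + z - w)) ^+ 2).[0]
      = t * (w.[0] ^+ 2) ^+ 2.
    by rewrite zE !(hornerD, hornerN, hornerM, horner_exp) s0 v0; ring.
  by rewrite mulf_neq0 // !expf_neq0.
Qed.

End FirstIterate.

End BihomogeneousForms.

(** * Growth of orbits near a point of the plane *)

Section PlaneContinuity.
Import numFieldNormedType.Exports.
Variable R : realType.
Local Notation C := R[i].
Implicit Types (x y : C * C).

(** One neighbourhood serves all instances of a universally quantified [P]; bounds that are locally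
    uniform in the point and valid for all [n] are stated in this way. *)
Definition nearby x (P : C * C -> Prop) :=
  exists2 r : R, 0 < r & forall y, cdist y x < r -> P y.

Lemma nearby_and x P Q : nearby x P -> nearby x Q -> nearby x (fun y => P y /\ Q y).
Proof.
move=> [r r0 hP] [s s0 hQ]; exists (Num.min r s); first by rewrite lt_min r0.
by move=> y; rewrite lt_min => /andP[/hP ? /hQ ?].
Qed.

Lemma nearby_sub x (P Q : C * C -> Prop) :
  (forall y, P y -> Q y) -> nearby x P -> nearby x Q.
Proof. by move=> PQ [r r0 hP]; exists r => // y /hP/PQ. Qed.

Lemma nearby_self x P : nearby x P -> P x.
Proof.
move=> [r r0 hP]; apply: hP.
have c0 (z : C) : cabs (z - z) = 0 by rewrite subrr cabs0.
by rewrite /cdist gt_max c0 c0 r0.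
Qed.

Definition ccont (f : C * C -> C) x :=
  forall e : R, 0 < e -> nearby x (fun y => cabs (f y - f x) < e).

Definition rcont (f : C * C -> R) x :=
  forall e : R, 0 < e -> nearby x (fun y => `|f y - f x| < e).

Lemma ccont_cst z x : ccont (fun=> z) x.
Proof. by move=> e e0; exists 1 => // y _; rewrite subrr cabs0. Qed.

Lemma ccont_fst x : ccont fst x.
Proof. by move=> e e0; exists e => // y; rewrite gt_max => /andP[]. Qed.

Lemma ccont_snd x : ccont snd x.
Proof. by move=> e e0; exists e => // y; rewrite gt_max => /andP[]. Qed.

Lemma ccontD f g x : ccont f x -> ccont g x -> ccont (fun y => f y + g y) x.
Proof.
move=> hf hg e e0; have e20 : 0 < e / 2 by rewrite divr_gt0.
apply: nearby_sub (nearby_and (hf _ e20) (hg _ e20)) => y [h1 h2].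
rewrite (_ : _ - _ = (f y - f x) + (g y - g x)); last by ring.
by apply: le_lt_trans (cabsD _ _) _; lra.
Qed.

Lemma ccontM f g x : ccont f x -> ccont g x -> ccont (fun y => f y * g y) x.
Proof.
move=> hf hg e e0; pose F := cabs (f x); pose G := cabs (g x).
have F0 : 0 <= F by exact: cabs_ge0.
have G0 : 0 <= G by exact: cabs_ge0.
pose d := Num.min 1 (e / (1 + F + G)).
have s0 : 0 < 1 + F + G by lra.
have d0 : 0 < d by rewrite lt_min ltr01 divr_gt0.
have d1 : d <= 1 by rewrite ge_min lexx.
have de : d * (1 + F + G) <= e by rewrite -ler_pdivlMr // ge_min lexx orbT.
apply: nearby_sub (nearby_and (hf _ d0) (hg _ d0)) => y [h1 h2].
set u := f y - f x in h1 *; set v := g y - g x in h2 *.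
rewrite (_ : _ - _ = u * v + (u * g x + f x * v)); last by rewrite /u /v; ring.
apply: le_lt_trans (cabsD _ _) _; rewrite cabsM.
apply: le_lt_trans (lerD (lexx _) (cabsD _ _)) _; rewrite !cabsM -/F -/G.
have u0 := cabs_ge0 u; have v0 := cabs_ge0 v.
have k1 : cabs u * cabs v < d * 1.
  apply: (@le_lt_trans _ _ (cabs u * 1)); last by rewrite ltr_pM2r.
  by rewrite ler_wpM2l // (le_trans (ltW h2)).
have k2 : cabs u * G <= d * G by rewrite ler_wpM2r // ltW.
have k3 : F * cabs v <= F * d by rewrite ler_wpM2l // ltW.
lra.
Qed.

Lemma ccont_ext f g x : f =1 g -> ccont f x -> ccont g x.
Proof. by move=> fg hf e /hf; apply: nearby_sub => y; rewrite !fg. Qed.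

Lemma ccont_evm (P : bipoly R) x : ccont (fun y => evm y P) x.
Proof.
elim/poly_ind: P => [|P c IH].
  by apply: (@ccont_ext (fun=> 0)) (ccont_cst _ _) => y; rewrite rmorph0.
apply: (@ccont_ext (fun y => evm y P * y.2 + c.[y.1])) => [y|].
  by rewrite rmorphD rmorphM /= evmC -/(t2 R) evm_t2.
apply: ccontD; first by apply: ccontM => //; exact: ccont_snd.
elim/poly_ind: c => [|c z IHc].
  by apply: (@ccont_ext (fun=> 0)) (ccont_cst _ _) => y; rewrite horner0.
apply: (@ccont_ext (fun y => c.[y.1] * y.1 + z)) => [y|]; first by rewrite !hornerE.
apply: ccontD (ccont_cst _ _); apply: ccontM => //; exact: ccont_fst.
Qed.

Lemma rcont_cabs f x : ccont f x -> rcont (fun y => cabs (f y)) x.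
Proof.
by move=> hf e /hf; apply: nearby_sub => y; apply: le_lt_trans (cabs_dist _ _).
Qed.

Lemma rcont_max f g x : rcont f x -> rcont g x ->
  rcont (fun y => Num.max (f y) (g y)) x.
Proof.
move=> hf hg e e0; apply: nearby_sub (nearby_and (hf _ e0) (hg _ e0)) => y [].
rewrite !ltr_norml; case: (leP (f x) (g x)); case: (leP (f y) (g y)); lra.
Qed.

Lemma rcont_cnorm f g x : ccont f x -> ccont g x ->
  rcont (fun y => cnorm (f y, g y)) x.
Proof. by move=> hf hg; apply: rcont_max; exact: rcont_cabs. Qed.

Lemma rcont_ln f x : 0 < f x -> rcont f x -> rcont (fun y => ln (f y)) x.
Proof.
move=> fx hf e e0.
have /cvgrPdist_lt/(_ e e0)/nbhs_ballP[r /= r0 hr] := continuous_ln fx.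
apply: nearby_sub (hf _ r0) => y h.
by rewrite distrC; apply: hr; rewrite /ball /= distrC.
Qed.

Lemma nearby_bounded f x : rcont f x -> nearby x (fun y => f y < f x + 1).
Proof.
by move=> /(_ 1 ltr01); apply: nearby_sub => y; rewrite ltr_norml; lra.
Qed.

Lemma nearby_pos f x : 0 < f x -> rcont f x -> nearby x (fun y => f x / 2 < f y).
Proof.
move=> fx /(_ (f x / 2)); rewrite divr_gt0 // => /(_ isT).
by apply: nearby_sub => y; rewrite ltr_norml; lra.
Qed.

End PlaneContinuity.

(** * Growth of norms along duplication orbits, uniformly near each point *)

Section OrbitGrowth.
Variable R : realType.
Local Notation C := R[i].

(** Let [r_n] be the ratio of the gap to the squared norm along the orbit. The estimate
    [c r_(n+1) >= (c r_n)^2] gives [c r_n >= rho ^+ (2 ^ n)], which is [inv]. Taking logarithms in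
    the other two bounds of [dup_estimate] then costs at most a multiple of [2 ^+ n]. *)
Lemma orbit_growth (m M d : R) : 0 < m -> m <= 1 -> 1 <= M -> 0 < d ->
  exists K : R, forall (a b : C) v, cabs a <= M -> cabs b <= M ->
    m <= cabs b -> m <= cabs (a - b) ->
    0 < cnorm v -> d * cnorm v ^+ 2 <= gap a v ->
    forall n, let w := iter n (dup a b) v in
    [/\ 0 < cnorm w,
        `|ln (cnorm (dup a b w)) - 4 * ln (cnorm w)| <= K * 2 ^+ n &
        expR (- (K * 2 ^+ n)) * cnorm w ^+ 2 <= gap a w].
Proof.
move=> m0 m1 M1 d0; have [c c0 hc] := dup_estimate m0 m1 M1.
pose rho := c * d; have rho0 : 0 < rho by rewrite mulr_gt0.
exists (`|ln c| + 2 * `|ln rho|) => a b v aM bM mb mab v0 gv n /=.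
set w := iter n (dup a b) v.
have inv k : let w := iter k (dup a b) v in
    0 < cnorm w /\ rho ^+ (2 ^ k) * cnorm w ^+ 2 <= c * gap a w.
  elim: k => [|k [IH1 IH2]] /=; first by rewrite expr1 -mulrA ler_pM2l.
  set z := iter k (dup a b) v in IH1 IH2 *.
  have [_ h2 h3] := hc a b z aM bM mb mab.
  have r0 : 0 < rho ^+ (2 ^ k) * cnorm z ^+ 2 by rewrite mulr_gt0 ?exprn_gt0.
  have g0 : 0 < gap a z by rewrite -(pmulr_rgt0 _ c0) (lt_le_trans r0).
  split; first by rewrite (lt_le_trans _ h2) // mulr_gt0 ?exprn_gt0.
  rewrite -(ler_pM2r (_ : 0 < cnorm z ^+ 4)) ?exprn_gt0 //.
  rewrite -[c * _ * _]mulrA; apply: le_trans (ler_wpM2l (ltW c0) h3).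
  have -> : c * (c * (gap a z ^+ 2 * cnorm (dup a b z) ^+ 2)) =
    (c * gap a z) ^+ 2 * cnorm (dup a b z) ^+ 2 by ring.
  have -> : rho ^+ (2 ^ k.+1) * cnorm (dup a b z) ^+ 2 * cnorm z ^+ 4 =
    (rho ^+ (2 ^ k) * cnorm z ^+ 2) ^+ 2 * cnorm (dup a b z) ^+ 2.
    by rewrite expnSr exprM; ring.
  by rewrite ler_wpM2r ?sqr_ge0 // ler_sqr ?nnegrE ?(ltW r0) // (le_trans (ltW r0)).
have [w0 gw] := inv n; rewrite -/w in w0 gw.
have [w1 _] := inv n.+1; rewrite /= -/w in w1.
have [h1 h2 _] := hc a b w aM bM mb mab.
have p1 : 1 <= 2 ^+ n :> R by rewrite exprn_ege1 // ler1n.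
have P0 : 0 < rho ^+ (2 ^ n) by rewrite exprn_gt0.
have lnP : ln (rho ^+ (2 ^ n)) = 2 ^+ n * ln rho.
  by rewrite lnXn // -[LHS]mulr_natl natrX.
have c1 : `|ln c| <= `|ln c| * 2 ^+ n by rewrite ler_peMr.
have a1 := ler_norm (ln c); have a2 := ler_norm (- ln c); rewrite normrN in a2.
have a3 : - `|ln rho| * 2 ^+ n <= 2 ^+ n * ln rho.
  by rewrite [leRHS]mulrC ler_wpM2r ?exprn_ge0 // lerNl -normrN ler_norm.
have a4 : 0 <= `|ln rho| * 2 ^+ n by rewrite mulr_ge0 ?exprn_ge0.
split=> //.
- have k1 : ln c + ln (cnorm (dup a b w)) <= 4 * ln (cnorm w).
    have := h1; rewrite -ler_ln ?posrE ?mulr_gt0 ?exprn_gt0 // lnM ?posrE //.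
    by rewrite lnXn // mulr_natl.
  have k2 : 2 * (2 ^+ n * ln rho) + 4 * ln (cnorm w) <=
      ln c + ln (cnorm (dup a b w)).
    rewrite -lnM ?posrE // -lnP !mulr_natl -!lnXn // -lnM ?posrE ?exprn_gt0 //.
    rewrite ler_ln ?posrE ?mulr_gt0 ?exprn_gt0 //.
    have := ler_wpM2l (ltW c0) h2; apply: le_trans.
    have -> : c * (c * gap a w ^+ 2) = (c * gap a w) ^+ 2 by ring.
    have -> : (rho ^+ (2 ^ n)) ^+ 2 * cnorm w ^+ 4 =
      (rho ^+ (2 ^ n) * cnorm w ^+ 2) ^+ 2 by ring.
    have q0 : 0 <= rho ^+ (2 ^ n) * cnorm w ^+ 2.
      exact: mulr_ge0 (ltW P0) (sqr_ge0 _).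
    by rewrite ler_sqr ?nnegrE // (le_trans q0).
  rewrite ler_norml; apply/andP; split; lra.
- rewrite -(ler_pM2l c0) mulrA; apply: le_trans gw.
  rewrite ler_wpM2r ?sqr_ge0 // -[leRHS]lnK ?posrE // lnP.
  rewrite -{1}[c]lnK ?posrE // -expRD ler_expR; lra.
Qed.

Lemma ln_compare (N W m M : R) : 0 < N -> 0 < m -> m * N <= W -> W <= M * N ->
  0 < W /\ `|ln W - ln N| <= `|ln m| + `|ln M|.
Proof.
move=> N0 m0 mW WM; have W0 : 0 < W by rewrite (lt_le_trans _ mW) ?mulr_gt0.
have M0 : 0 < M by rewrite -(pmulr_lgt0 _ N0) (lt_le_trans W0).
split=> //.
have : ln m + ln N <= ln W by rewrite -lnM ?posrE // ler_ln ?posrE ?mulr_gt0.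
have : ln W <= ln M + ln N by rewrite -lnM ?posrE // ler_ln ?posrE ?mulr_gt0.
have := ler_norm (- ln m); rewrite normrN; have := ler_norm (ln M).
have := normr_ge0 (ln m); have := normr_ge0 (ln M).
rewrite ler_norml; move=> *; apply/andP; split; lra.
Qed.

Definition dup_bounded (m M : R) (a b : C) :=
  [/\ cabs a <= M, cabs b <= M, m <= cabs b & m <= cabs (a - b)].

(** The hypotheses of [orbit_growth] follow from open conditions at [x], so they hold nearby with
    common constants, although the parameters [a] and [b] vary with the point. *)
Lemma local_orbit_growth (fa fb fA fB : C * C -> C) x :
  ccont fa x -> ccont fb x -> ccont fA x -> ccont fB x ->
  fb x != 0 -> fa x - fb x != 0 -> ~ (fA x = 0 /\ fB x = 0) ->
  (fa x = 0 -> fA x != 0) ->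
  exists m M K : R, [/\ 0 < m, m <= 1, 1 <= M & nearby x (fun y =>
    dup_bounded m M (fa y) (fb y) /\ forall n,
    let w := iter n (dup (fa y) (fb y)) (fA y, fB y) in
    [/\ 0 < cnorm w,
        `|ln (cnorm (dup (fa y) (fb y) w)) - 4 * ln (cnorm w)| <= K * 2 ^+ n &
        expR (- (K * 2 ^+ n)) * cnorm w ^+ 2 <= gap (fa y) w])].
Proof.
move=> ca cb cA cB b0 ab0 nz a0.
have cab : ccont (fun y => fa y - fb y) x.
  apply: (@ccont_ext _ (fun y => fa y + (-1) * fb y)) => [y|].
    by rewrite mulN1r.
  by apply: ccontD => //; apply: ccontM => //; exact: ccont_cst.
have cN := rcont_cnorm cA cB.
have N0 : 0 < cnorm (fA x, fB x).
  rewrite lt_max !cabs_gt0; apply/orP.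
  have [A0|] := eqVneq (fA x) 0; last by left.
  by right; apply/eqP => B0; apply: nz.
pose m := Num.min 1 (Num.min (cabs (fb x) / 2) (cabs (fa x - fb x) / 2)).
pose M := 1 + cabs (fa x) + cabs (fb x).
have m0 : 0 < m by rewrite !lt_min ltr01 !divr_gt0 ?cabs_gt0.
have m1 : m <= 1 by rewrite ge_min lexx.
have M1 : 1 <= M by rewrite /M -addrA lerDl addr_ge0 ?cabs_ge0.
have nb : nearby x (fun y => dup_bounded m M (fa y) (fb y)).
  have h1 := nearby_bounded (rcont_cabs ca).
  have h2 := nearby_bounded (rcont_cabs cb).
  have h3 := @nearby_pos _ (fun y => cabs (fb y)) x _ (rcont_cabs cb).
  rewrite cabs_gt0 in h3.
  have h4 := @nearby_pos _ (fun y => cabs (fa y - fb y)) x _ (rcont_cabs cab).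
  rewrite cabs_gt0 in h4.
  have := nearby_and (nearby_and h1 h2) (nearby_and (h3 b0) (h4 ab0)).
  apply: nearby_sub => y [[k1 k2] [k3 k4]].
  have a_0 := cabs_ge0 (fa x); have b_0 := cabs_ge0 (fb x).
  split; rewrite ?ge_min ?(ltW k3) ?(ltW k4) ?orbT // /M; lra.
(* The gap is bounded below by its term [|A|^2] if [a] vanishes at [x], and by its term in [|a|]
   otherwise. *)
have ng : exists2 g : R, 0 < g &
    nearby x (fun y => g <= gap (fa y) (fA y, fB y)).
  have [az|anz] := eqVneq (fa x) 0.
    have A0 : 0 < cabs (fA x) by rewrite cabs_gt0 a0.
    exists ((cabs (fA x) / 2) ^+ 2); first by rewrite exprn_gt0 ?divr_gt0.
    apply: nearby_sub (nearby_pos A0 (rcont_cabs cA)) => y h.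
    by rewrite le_max ler_sqr ?nnegrE ?divr_ge0 ?cabs_ge0 ?(ltW h).
  have a_0 : 0 < cabs (fa x) by rewrite cabs_gt0.
  exists (cabs (fa x) / 2 * (cnorm (fA x, fB x) / 2) ^+ 2).
    by rewrite mulr_gt0 ?exprn_gt0 ?divr_gt0.
  have := nearby_and (nearby_pos a_0 (rcont_cabs ca)) (nearby_pos (f := fun y => cnorm (fA y, fB y)) N0 cN).
  apply: nearby_sub => y [k1 k2]; rewrite le_max; apply/orP; right.
  apply: ler_pM; rewrite ?sqr_ge0 ?divr_ge0 ?cabs_ge0 ?(ltW k1) //.
  by rewrite ler_sqr ?nnegrE ?divr_ge0 ?cnorm_ge0 ?(ltW k2).
have [g g0 hg] := ng.
pose S := cnorm (fA x, fB x) + 1.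
have S0 : 0 < S by rewrite addr_gt0.
have [K hK] := orbit_growth m0 m1 M1 (divr_gt0 g0 (exprn_gt0 2 S0)).
exists m, M, K; split=> //.
have := nearby_and (nearby_and nb hg) (nearby_and (nearby_pos (f := fun y => cnorm (fA y, fB y)) N0 cN) (nearby_bounded cN)).
apply: nearby_sub => y [[by_ gy] [Ny NS]]; split=> //.
have [k1 k2 k3 k4] := by_; apply: hK => //.
  by rewrite (lt_trans _ Ny) // divr_gt0.
apply: le_trans gy; rewrite mulrAC ler_pdivrMr ?exprn_gt0 //.
by rewrite ler_pM2l // ler_sqr ?nnegrE ?cnorm_ge0 ?(ltW S0) // ltW.
Qed.

Lemma dupC (a b : C) v : dup a b v = dup b a v.
Proof. by rewrite /dup; congr (_, _); ring. Qed.

(* Translation by the [2]-torsion point [x = t]. *)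
Definition shear (t : C) (v : C * C) : C * C := (v.1 - t * v.2, v.2).

(** The roots [0], [a], [b] of the cubic move to [- a], [0], [b - a]. So the node [x = a] of a fibre
    with [a = b] becomes the node [x = 0] with vanishing first parameter. *)
Lemma dup_shear (a b : C) v :
  shear a (dup a b v) = dup (b - a) (- a) (shear a v).
Proof. by rewrite /shear /dup /=; congr (_, _); ring. Qed.

Lemma iter_dup_shear (a b : C) v n :
  shear a (iter n (dup a b) v) = iter n (dup (b - a) (- a)) (shear a v).
Proof. by elim: n => //= n <-; rewrite dup_shear. Qed.

Lemma cnorm_shear (t : C) v M : cabs t <= M -> 1 <= M ->
  cnorm (shear t v) <= 2 * M * cnorm v /\ cnorm v <= 2 * M * cnorm (shear t v).
Proof.
move=> tM M1.
have aux (z : C) (w : C * C) : cabs z <= M ->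
    cabs (w.1 + z * w.2) <= 2 * M * cnorm w /\ cabs w.2 <= 2 * M * cnorm w.
  move=> zM; have w1 := cnorm_ge1 w; have w2 := cnorm_ge2 w.
  have w0 := cnorm_ge0 w.
  have h1 : cnorm w <= M * cnorm w by rewrite ler_peMl.
  have h2 : cabs z * cabs w.2 <= M * cnorm w by rewrite ler_pM ?cabs_ge0.
  have h3 := cabsD w.1 (z * w.2); rewrite cabsM in h3.
  split; lra.
split; rewrite ge_max; apply/andP.
  by have := aux (- t) v; rewrite cabsN mulNr => /(_ tM).
by have := aux t (shear t v) tM; rewrite /= subrK.
Qed.

Variables (A B : bipoly R).
Hypothesis nz : forall x, punct x -> ~ (evm x A = 0 /\ evm x B = 0).
(** On each degenerate line the initial pair avoids the node, which is [x = 0] on the axes and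
    [x = t] on the diagonal. *)
Hypothesis nz_t1 : forall t : C, t != 0 -> evm (0, t) A != 0.
Hypothesis nz_t2 : forall t : C, t != 0 -> evm (t, 0) A != 0.
Hypothesis nz_diag : forall t : C, t != 0 -> evm (t, t) A - t * evm (t, t) B != 0.

Definition orbit n (y : C * C) := iter n (dup y.1 y.2) (evm y A, evm y B).

(** The norm of the iterate [(A_n, t2 B_n)] of [F], whereas the estimates above concern the pair
    [(A_n, B_n)]. *)
Definition size_at n (y : C * C) := cnorm ((orbit n y).1, y.2 * (orbit n y).2).

(** The [6] is [2 + 4]: the error at rank [n + 1] is [L * 2 ^+ n.+1], and the one at rank [n] is
    multiplied by [4]. *)
Lemma growth_transfer (N W : nat -> R) (K L : R) :
  (forall n, 0 < N n /\ `|ln (N n.+1) - 4 * ln (N n)| <= K * 2 ^+ n) ->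
  (forall n, 0 < W n /\ `|ln (W n) - ln (N n)| <= L * 2 ^+ n) ->
  forall n, 0 < W n /\ `|ln (W n.+1) - 4 * ln (W n)| <= (K + 6 * L) * 2 ^+ n.
Proof.
move=> hN hW n; have [W0 w] := hW n; split=> //.
have [_ w'] := hW n.+1; have [_ h] := hN n.
move: w w' h; rewrite exprS !ler_norml => /andP[? ?] /andP[? ?] /andP[? ?].
by apply/andP; split; lra.
Qed.

Lemma cnorm_scale2 (v : C * C) (t : C) (m M : R) : m <= 1 -> 1 <= M ->
  m <= cabs t -> cabs t <= M ->
  m * cnorm v <= cnorm (v.1, t * v.2) /\ cnorm (v.1, t * v.2) <= M * cnorm v.
Proof.
move=> m1 M1 mt tM; have v1 := cabs_ge0 v.1; have v2 := cabs_ge0 v.2.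
have p : m * cabs v.1 <= cabs v.1 by rewrite ler_piMl.
have p' : cabs v.1 <= M * cabs v.1 by rewrite ler_peMl.
have q : m * cabs v.2 <= cabs t * cabs v.2 by rewrite ler_wpM2r.
have q' : cabs t * cabs v.2 <= M * cabs v.2 by rewrite ler_wpM2r.
rewrite /cnorm /= cabsM.
case: (leP (cabs v.1) (cabs v.2)) => h; case: (leP (cabs v.1) (cabs t * cabs v.2)) => h'.
- by split.
- split; [lra|apply: le_trans p' _; rewrite ler_wpM2l //; lra].
- split; [lra|apply: le_trans q' _; rewrite ler_wpM2l //; lra].
- by split.
Qed.

(** On the diagonal the orbit is sheared; elsewhere with [t2] nonzero, [t1] is the parameter that
    may vanish; on [t2 = 0] the two parameters are exchanged. In the first two cases [|t2|] is
    bounded below, so [(A, B)] and [(A, t2 B)] have comparable norms. *)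
Lemma local_growth x : punct x -> exists K : R, nearby x (fun y => forall n,
  0 < size_at n y /\
  `|ln (size_at n.+1 y) - 4 * ln (size_at n y)| <= K * 2 ^+ n).
Proof using nz nz_t1 nz_t2 nz_diag.
move=> px.
have cA := ccont_evm A x; have cB := ccont_evm B x.
have c1 := @ccont_fst R x; have c2 := @ccont_snd R x.
have p1 n : 1 <= 2 ^+ n :> R by rewrite exprn_ege1 // ler1n.
have const (L : R) n : 0 <= L -> L <= L * 2 ^+ n by move=> L0; rewrite ler_peMr ?p1.
have [e12|n12] := eqVneq x.1 x.2.
- have x20 : x.2 != 0.
    by apply: contra_notN px => /eqP e; rewrite (surjective_pairing x) e12 e.
  have xE : x = (x.2, x.2) by case: (x) e12 => ? ? /= ->.
  have cN1 : ccont (fun y : C * C => - y.1) x.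
    apply: (@ccont_ext _ (fun y => (-1) * y.1)) => [y|]; first by rewrite mulN1r.
    by apply: ccontM => //; exact: ccont_cst.
  have cab : ccont (fun y : C * C => y.2 - y.1) x by exact: ccontD.
  have csA : ccont (fun y => evm y A - y.1 * evm y B) x.
    apply: (@ccont_ext _ (fun y => evm y A + (- y.1) * evm y B)) => [y|].
      by rewrite mulNr.
    by apply: ccontD => //; exact: ccontM.
  have sA0 : evm x A - x.1 * evm x B != 0 by rewrite xE /= nz_diag.
  have [||||m [M [K [m0 m1 M1 hK]]]] := local_orbit_growth cab cN1 csA cB.
  + by rewrite oppr_eq0 e12.
  + by rewrite opprK subrK.
  + by move=> [/eqP]; rewrite (negPf sA0).
  + by [].
  pose L : R := `|ln (m / (2 * M))| + `|ln (2 * M * (2 * M))|.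
  have M0 : 0 < M by exact: lt_le_trans M1.
  exists (K + 6 * L); apply: nearby_sub hK => y [[k1 k2 k3 k4] hn].
  pose N n := cnorm (shear y.1 (orbit n y)).
  have NE n : N n = cnorm (iter n (dup (y.2 - y.1) (- y.1))
      (evm y A - y.1 * evm y B, evm y B)) by rewrite /N iter_dup_shear.
  rewrite opprK subrK in k4; rewrite cabsN in k2.
  have y2M : cabs y.2 <= 2 * M.
    by have := cabsD (y.2 - y.1) y.1; rewrite subrK; lra.
  have M2 : 1 <= 2 * M by lra.
  apply: (growth_transfer (N := N)) => n.
    by have [h1 h2 _] := hn n; rewrite !NE.
  have [N0 _ _] := hn n; rewrite -NE in N0.
  have [s1 s2] := cnorm_shear (orbit n y) k2 M1.
  have [l1 l2] := cnorm_scale2 (orbit n y) m1 M2 k4 y2M.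
  have [|||W0 h] := @ln_compare (N n) (size_at n y) (m / (2 * M)) (2 * M * (2 * M)) N0.
  + by rewrite divr_gt0 // mulr_gt0.
  + apply: le_trans l1; rewrite mulrAC ler_pdivrMr ?mulr_gt0 //.
    by rewrite -mulrA ler_pM2l // mulrC.
  + by apply: (le_trans l2); rewrite -[leRHS]mulrA ler_pM2l ?mulr_gt0.
  split=> //; apply: (le_trans h); apply: const; exact: addr_ge0.
have [x20|x20] := eqVneq x.2 0; last first.
- have [||||m [M [K [m0 m1 M1 hK]]]] := local_orbit_growth c1 c2 cA cB.
  + by [].
  + by rewrite subr_eq0.
  + exact: nz.
  + by case: (x) x20 => a b /= b0 ->; exact: nz_t1.
  pose L : R := `|ln m| + `|ln M|.
  exists (K + 6 * L); apply: nearby_sub hK => y [[k1 k2 k3 k4] hn].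
  apply: (growth_transfer (N := fun n => cnorm (orbit n y))) => n.
    by have [h1 h2 _] := hn n.
  have [N0 _ _] := hn n.
  have [l1 l2] := cnorm_scale2 (orbit n y) m1 M1 k3 k2.
  have [W0 h] := ln_compare N0 m0 l1 l2.
  split=> //; apply: (le_trans h); apply: const; exact: addr_ge0.
have x10 : x.1 != 0 by rewrite -x20.
have [||||m [M [K [m0 m1 M1 hK]]]] := local_orbit_growth c2 c1 cA cB.
- by [].
- by rewrite subr_eq0 eq_sym.
- exact: nz.
- by case: (x) x10 => a b /= a0 ->; exact: nz_t2.
have K0 : 0 <= K.
  have [_ /(_ 0%N)[_ + _]] := nearby_self hK.
  by rewrite expr0 mulr1; exact: le_trans.
(* Here [t2] may vanish, and the two norms are compared only up to the factor
   [expR (- (K * 2 ^+ n))]. The resulting error in the logarithm is still a multiple of [2 ^+ n]. *)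
pose L : R := K + `|ln M|.
exists (K + 6 * L); apply: nearby_sub hK => y [[k1 k2 k3 k4] hn].
have oE n : orbit n y = iter n (dup y.2 y.1) (evm y A, evm y B).
  by apply: eq_iter => v; exact: dupC.
apply: (growth_transfer (N := fun n => cnorm (orbit n y))) => n.
  by have [h1 h2 _] := hn n; rewrite !oE.
have [N0 _ gp] := hn n; rewrite -oE in N0 gp.
have K20 : 0 <= K * 2 ^+ n by rewrite mulr_ge0 ?exprn_ge0.
set e := expR _ in gp.
have e0 : 0 < e by exact: expR_gt0.
have e1 : e <= 1 by rewrite -expR0 ler_expR oppr_le0.
have l2 : size_at n y <= M * cnorm (orbit n y).
  have v1 := cnorm_ge1 (orbit n y); have v2 := cnorm_ge2 (orbit n y).
  rewrite ge_max /= cabsM; apply/andP; split.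
    by apply: (le_trans v1); rewrite ler_peMl ?cnorm_ge0.
  by rewrite ler_pM ?cabs_ge0.
(* The bound on the gap leaves two cases, [|A_n|] at least [e] times the norm of the pair or
   [|t2| >= e]; either one suffices. *)
have l1 : e * cnorm (orbit n y) <= size_at n y.
  have W1 : cabs (orbit n y).1 <= size_at n y by rewrite le_max lexx.
  have W2 : cabs y.2 * cabs (orbit n y).2 <= size_at n y.
    by rewrite le_max /= cabsM lexx orbT.
  move: gp; rewrite le_max => /orP[gp|gp].
    rewrite -(ler_pM2r N0) -mulrA -expr2 (le_trans gp) // expr2 ler_pM ?cabs_ge0 //.
    exact: cnorm_ge1.
  have ey : e <= cabs y.2 by rewrite ler_pM2r ?exprn_gt0 in gp.
  rewrite [X in e * X]/cnorm; case: (leP (cabs (orbit n y).1)) => _.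
    by apply: le_trans W2; rewrite ler_wpM2r ?cabs_ge0.
  by apply: le_trans W1; rewrite ler_piMl ?cabs_ge0.
have [W0 h] := ln_compare N0 e0 l1 l2.
split=> //; apply: (le_trans h); rewrite /L mulrDl lerD ?const //.
by rewrite /e expRK normrN ger0_norm.
Qed.

End OrbitGrowth.

(** * Sub-mean value inequality *)

Section RealAnalysis.
Import numFieldNormedType.Exports.
Variable R : realType.

(** The supremum of the points reached from [a] can be passed unless it is [b]: compactness of the
    segment as an induction principle. *)
Lemma interval_glue (Q : R -> R -> Prop) (a b : R) : a <= b ->
  (forall s t u, s <= t -> t <= u -> Q s t -> Q t u -> Q s u) ->
  (forall x, exists2 r, 0 < r &
     forall s t, x - r < s -> s <= t -> t < x + r -> Q s t) ->
  Q a b.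
Proof.
move=> ab glue loc.
pose E := [set x | a <= x <= b /\ Q a x]%classic.
have Ea : E a.
  split; first by rewrite lexx.
  by have [r r0 h] := loc a; apply: h; rewrite ?ltrBlDr ?ltrDl.
have ubE : ubound E b by move=> x [/andP[]].
have hE : has_sup E by split; [exists a | exists b].
pose c := sup E.
have ac : a <= c by apply: ub_le_sup => //; case: hE.
have cb : c <= b by apply: ge_sup => //; case: hE.
have [r r0 h] := loc c.
have [x [/andP[ax xb] Qx] xc] := sup_adherent r0 hE.
have xlec : x <= c by apply: ub_le_sup => //; [case: hE | split; rewrite ?ax].
pose t := Num.min b (c + r / 2).
have ct : c <= t by rewrite le_min cb lerDl divr_ge0 ?ltW.
have Qt : Q a t.
  apply: (glue _ _ _ ax (le_trans xlec ct) Qx); apply: h => //.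
    exact: le_trans ct.
  by rewrite gt_min ltrD2l ltr_pdivrMr // ltr_pMr // ltr1n orbT.
have tE : t <= c.
  apply: ub_le_sup => //; first by case: hE.
  by split=> //; rewrite ge_min lexx (le_trans ac).
have [bt|] := leP b (c + r / 2); first by rewrite (_ : b = t) // /t (min_l bt).
by move: tE; rewrite /t => /[swap] /ltW/min_r ->; rewrite gerDl leNgt divr_gt0.
Qed.

Definition econtinuous (h : R -> R) := forall x e, 0 < e ->
  exists2 r, 0 < r & forall y, `|y - x| < r -> `|h y - h x| < e.

Lemma econtinuous_uniform h a b e : econtinuous h -> a <= b -> 0 < e ->
  exists2 r, 0 < r & forall x y, a <= x <= b -> `|y - x| < r -> `|h y - h x| < e.
Proof.
move=> hc ab e0.
pose Q s t := exists2 r, 0 < r &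
  forall x y, s <= x <= t -> `|y - x| < r -> `|h y - h x| < e.
apply: (@interval_glue Q) => // [s t u st tu [r r0 hr] [r' r'0 hr']|x].
  exists (Num.min r r') => [|x y /andP[sx xu]]; first by rewrite lt_min r0.
  rewrite lt_min => /andP[yr yr'].
  by have [xt|/ltW tx] := leP x t; [apply: hr | apply: hr']; rewrite ?sx ?tx ?xt.
have e20 : 0 < e / 2 by rewrite divr_gt0.
have [r r0 hr] := hc x _ e20.
exists (r / 2) => [|s t xs st tx]; first by rewrite divr_gt0.
exists (r / 2) => [|z y /andP[sz zt] yz]; first by rewrite divr_gt0.
have zx : `|z - x| < r / 2 by rewrite ltr_norml; lra.
have h1 : `|h z - h x| < e / 2 by apply: hr; lra.
have h2 : `|h y - h x| < e / 2.
  apply: hr; have := ler_normD (y - z) (z - x).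
  by rewrite addrA subrK; lra.
have := ler_normB (h y - h x) (h z - h x).
by rewrite opprB addrA subrK; lra.
Qed.

Lemma econtinuousP h : econtinuous h -> continuous h.
Proof.
move=> hc x; apply/cvgrPdist_lt => e e0.
have [r r0 hr] := hc x e e0; apply/nbhs_ballP; exists r => //= y.
by rewrite /ball /= => xy; rewrite distrC; apply: hr; rewrite distrC.
Qed.

Lemma econtinuous_integrable h a b : econtinuous h ->
  lebesgue_measure.-integrable `[a, b]%classic (EFin \o h).
Proof.
move=> /econtinuousP hc; apply: continuous_compact_integrable.
  exact: segment_compact.
exact: continuous_subspaceT.
Qed.

Lemma econtinuous_integrable_oc h a b : econtinuous h ->
  lebesgue_measure.-integrable `]a, b]%classic (EFin \o h).
Proof.
move=> /(@econtinuous_integrable h a b) hi; apply: integrableS hi => //.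
by apply: subset_itvr; rewrite bnd_simp.
Qed.

Lemma exp2_large (x : R) : exists m : nat, forall n, (m <= n)%N -> x < 2 ^+ n.
Proof.
have [m xm] : exists m : nat, x < m%:R.
  by exists (Num.truncn x).+1; rewrite truncnS_gt.
exists m => n mn; apply: (lt_le_trans xm); rewrite -natrX ler_nat.
by rewrite (leq_trans mn) // ltnW // ltn_expl.
Qed.

(** As [phi] lies in [[0, 2 pi]], there is one node in each of the [2 ^ m] equal subintervals, and
    the sums are Riemann sums. The deficit [K] does not depend on [m] and disappears on division by
    [2 ^+ m]. *)
Lemma riemann_le_integral (h : R -> R) (L K : R) : econtinuous h ->
  (forall m : nat, exists2 phi : R, 0 <= phi <= 2 * pi &
     2 ^+ m * L - K <= \sum_(k < 2 ^ m) h ((phi + 2 * pi * k%:R) / 2 ^+ m)) ->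
  L <= (2 * pi)^-1 * Rintegral lebesgue_measure `[0, 2 * pi]%classic h.
Proof.
move=> hc hm.
have pi2 : 0 < 2 * pi :> R by rewrite mulr_gt0 // pi_gt0.
rewrite ler_pdivlMl //; apply/ler_addgt0Pr => e e0.
(* Half of [e] pays for the oscillation of [h], half for the deficit [K]. *)
pose d := e / (4 * pi).
have d0 : 0 < d by rewrite divr_gt0 // mulr_gt0 // pi_gt0.
have [r r0 hr] := econtinuous_uniform hc (ltW pi2) d0.
have [m1 hm1] := exp2_large (2 * pi / r).
have [m2 hm2] := exp2_large (K / d).
pose m := maxn m1 m2; pose N : R := 2 ^+ m.
have N0 : 0 < N by rewrite exprn_gt0.
have Nr : 2 * pi / N < r.
  have := hm1 m (leq_maxl _ _); rewrite ltr_pdivrMr // => lt.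
  by rewrite ltr_pdivrMr // (mulrC r).
have NK : K / N < d.
  have := hm2 m (leq_maxr _ _); rewrite ltr_pdivrMr // => lt.
  by rewrite ltr_pdivrMr // (mulrC d).
have [phi /andP[phi0 phi2] hphi] := hm m.
pose x k : R := 2 * pi * k%:R / N.
pose th k : R := (phi + 2 * pi * k%:R) / N.
have xS k : x k.+1 = x k + 2 * pi / N by rewrite /x -natr1; field; rewrite gt_eqF.
have xE : x (2 ^ m)%N = 2 * pi by rewrite /x natrX mulfK // gt_eqF.
have x0 k : 0 <= x k.
  by apply: divr_ge0 (ltW N0); apply: mulr_ge0 (ltW pi2) _.
have step : 0 <= 2 * pi / N by exact: divr_ge0 (ltW pi2) (ltW N0).
have main k : (k <= 2 ^ m)%N ->
    2 * pi / N * \sum_(j < k) (h (th j) - d) <=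
    Rintegral lebesgue_measure `[0, x k]%classic h.
  elim: k => [_|k IH kN].
    by rewrite big_ord0 mulr0 /x mulr0 mul0r set_itv1 Rintegral_set1.
  have xk : x k <= x k.+1 by rewrite xS lerDl.
  have xN : x k.+1 <= 2 * pi.
    by rewrite -xE ler_pM2r ?invr_gt0 // ler_pM2l // ler_nat.
  have int := @econtinuous_integrable h 0 (x k.+1) hc.
  have := @Rintegral_itvB R h (BLeft 0) (BRight (x k.+1)) (x k) int.
  rewrite !bnd_simp => /(_ (x0 _) xk) /eqP; rewrite subr_eq => /eqP ->.
  rewrite big_ord_recr /= mulrDr addrC lerD //; last exact: IH (ltnW kN).
  have -> : 2 * pi / N * (h (th k) - d) =
      Rintegral lebesgue_measure `]x k, x k.+1]%classic (fun=> h (th k) - d).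
    rewrite Rintegral_cst // mulrC; congr (_ * _).
    rewrite [X in fine X]lebesgue_measure_itv /= lte_fin lt_neqAle xk andbT.
    rewrite xS -subr_eq0 opprD addNKr oppr_eq0 gt_eqF ?divr_gt0 //=.
    by rewrite addrC addKr.
  apply: le_Rintegral => //.
  - apply: econtinuous_integrable_oc => z ? ?.
    by exists 1 => // y _; rewrite subrr normr0.
  - exact: econtinuous_integrable_oc.
  move=> z; rewrite /= in_itv /= => /andP[xz zx].
  have thk : x k <= th k <= x k.+1.
    rewrite xS /x /th -mulrDl !ler_pM2r ?invr_gt0 //.
    by rewrite lerDr phi0 addrC lerD2l.
  have : `|h (th k) - h z| < d.
    apply: hr; first by rewrite (le_trans (x0 k) (ltW xz)) (le_trans zx).
    apply: le_lt_trans Nr; rewrite ler_norml; move: thk zx xz; rewrite xS; lra.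
  rewrite ltr_norml; lra.
have := main _ (leqnn _); rewrite xE => h1.
rewrite -lerBlDr (le_trans _ h1) // big_split /= sumr_const card_ord.
have h2 : 2 * pi / N * (N * L - K) <= 2 * pi / N * \sum_(j < 2 ^ m) h (th j).
  by rewrite ler_wpM2l.
have eN : (- d) *+ 2 ^ m = - d * N by rewrite -[LHS]mulr_natr natrX.
have h3 := lerD h2 (lexx (2 * pi / N * (- d * N))).
rewrite eN [leRHS]mulrDr; apply: le_trans h3.
have -> : 2 * pi / N * (N * L - K) + 2 * pi / N * (- d * N) =
   2 * pi * L - 2 * pi * (K / N) - 2 * pi * d by field; rewrite gt_eqF.
have ed : d * (4 * pi) = e by rewrite divfK // mulf_neq0 // gt_eqF ?pi_gt0.
have : 2 * pi * (K / N) <= 2 * pi * d by rewrite ler_wpM2l // ltW.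
move: ed; lra.
Qed.

End RealAnalysis.

(** * Jensen's inequality for polynomials, discretised on equidistant nodes of the circle *)

Section SubMeanValue.
Variable R : realType.
Local Notation C := R[i].

Lemma expiD (a b : R) : expi (a + b) = expi a * expi b.
Proof.
apply/eqP; rewrite eq_complex /= cosD sinD; apply/andP; split=> //.
by rewrite addrC [cos a * _]mulrC [sin a * _]mulrC addrC [_ * cos a]mulrC [_ * sin a]mulrC.
Qed.

Lemma expiDpi (a : R) : expi (a + pi) = - expi a.
Proof.
by apply/eqP; rewrite eq_complex /= cosDpi sinDpi !eqxx.
Qed.

Lemma cabs_expi (a : R) : cabs (expi a) = 1.
Proof. by rewrite /cabs /= cos2Dsin2 sqrtr1. Qed.

Lemma Re_le_cabs (z : C) : `|complex.Re z| <= cabs z.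
Proof.
case: z => x y /=; rewrite /cabs /= -sqrtr_sqr ler_wsqrtr //.
by rewrite lerDl sqr_ge0.
Qed.

(** The nodes are the roots of order [2 ^ m] of [expi phi]. The induction pairs opposite nodes [w]
    and [- w], whose common squares are the nodes of the previous level. *)
Lemma prod_expi_nodes m (phi : R) (z : C) :
  \prod_(k < 2 ^ m) (z - expi ((phi + 2 * pi * k%:R) / 2 ^+ m)) =
  z ^+ (2 ^ m) - expi phi.
Proof.
elim: m z => [|m IH] z.
  by rewrite big_ord1 /= mulr0 addr0 divr1 expr1.
rewrite expnS mul2n -addnn big_split_ord /= -big_split /=.
under eq_bigr => k _.
  have -> : (phi + 2 * pi * (2 ^ m + k)%:R) / 2 ^+ m.+1 =
      (phi + 2 * pi * k%:R) / 2 ^+ m.+1 + pi.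
    rewrite natrD natrX exprS; field.
    by rewrite expf_neq0 // pnatr_eq0.
  rewrite expiDpi opprK.
  have -> : forall w : C, (z - w) * (z + w) = z ^+ 2 - w * w by move=> w; ring.
  rewrite -expiD.
  have -> : (phi + 2 * pi * k%:R) / 2 ^+ m.+1 + (phi + 2 * pi * k%:R) / 2 ^+ m.+1
      = (phi + 2 * pi * k%:R) / 2 ^+ m.
    by rewrite exprS; field; rewrite expf_neq0 // pnatr_eq0.
  over.
by rewrite IH -exprM mul2n addnn.
Qed.

(* Pigeonhole: [size s + 1] separated candidates on the circle, each [w] in [s]
   is too close to at most one of them. *)
Lemma expi_far_from (s : seq C) : exists2 phi : R, 0 <= phi <= pi &
  forall w, w \in s -> cabs w <= 4 * (size s).+1%:R * cabs (w - expi phi).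
Proof.
(* These are the cosines of the candidate angles; their spacing separates the real parts of the
   candidates. *)
set n := size s; pose a (i : 'I_n.+1) : R := i%:R / n.+1%:R.
have n0 : 0 < n.+1%:R :> R by rewrite ltr0n.
have a01 i : -1 <= a i <= 1.
  rewrite (le_trans (_ : _ <= 0)) ?divr_ge0 ?lerN10 //=.
  by rewrite ler_pdivrMr // mul1r ler_nat ltnW.
apply: contrapT => /forall2NP H.
have bad i : exists2 w, w \in s & 4 * n.+1%:R * cabs (w - expi (acos (a i))) < cabs w.
  case: (H (acos (a i))) => [|/existsNP[w /not_implyP[ws /negP]]].
    by rewrite acos_ge0 ?acos_lepi.
  by rewrite -ltNge; exists w.
have idx i : exists j : 'I_n, 4 * n.+1%:R * cabs (s`_j - expi (acos (a i))) < cabs s`_j.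
  have [w ws hw] := bad i; have js : (index w s < n)%N by rewrite index_mem.
  by exists (Ordinal js); rewrite /= nth_index.
have [f hf] := choice idx.
have : injective f.
  move=> i j fij; apply/val_inj/eqP; apply: contraT => ij.
  have := hf i; have := hf j; rewrite -fij; set w := s`_(f i) => hj hi.
  have w1 : cabs w <= 1 + cabs (w - expi (acos (a i))).
    by rewrite -(cabs_expi (acos (a i))) -{1}(subrK (expi (acos (a i))) w) addrC cabsD.
  have dist : cabs (expi (acos (a i)) - expi (acos (a j))) <=
      cabs (w - expi (acos (a i))) + cabs (w - expi (acos (a j))).
    rewrite (cabs_subC w (expi (acos (a i)))).
    by rewrite (le_trans _ (cabsD _ _)) // addrA subrK.
  have re : `|a i - a j| <= cabs (expi (acos (a i)) - expi (acos (a j))).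
    apply: le_trans (Re_le_cabs _) => /=.
    by rewrite !acosK // in_itv /=.
  have sep : n.+1%:R^-1 <= `|a i - a j|.
    rewrite /a -mulrBl normrM (ger0_norm (_ : 0 <= n.+1%:R^-1)) ?invr_ge0 //.
    rewrite ler_peMl ?invr_ge0 //.
    have [ltij|ltji|/eqP] := ltngtP i j; last by rewrite (negPf ij).
      by rewrite distrC -natrB ?(ltnW ltij) // normr_nat ler1n subn_gt0.
    by rewrite -natrB ?(ltnW ltji) // normr_nat ler1n subn_gt0.
  have n1 : 1 <= n.+1%:R :> R by rewrite ler1n.
  set u := cabs (w - expi (acos (a i))) in hi w1 dist *.
  set v := cabs (w - expi (acos (a j))) in hj dist *.
  have u0 : 0 <= u by rewrite cabs_ge0.
  have v0 : 0 <= v by rewrite cabs_ge0.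
  have h1 : n.+1%:R * n.+1%:R^-1 <= n.+1%:R * (u + v).
    by rewrite ler_pM2l // (le_trans sep) // (le_trans re).
  rewrite divff ?gt_eqF // in h1.
  have h2 : u <= n.+1%:R * u by rewrite ler_peMl.
  move: hi hj h1 h2 w1; lra.
by move/leq_card; rewrite !card_ord ltnn.
Qed.

(** After factoring [p], the product over the nodes that belongs to a root [z] is
    [|z^(2^m) - expi phi|]. The angle from [expi_far_from] keeps it above a fixed multiple of
    [|z|^(2^m)], one multiple for each root, so [k] is independent of [m]. *)
Lemma poly_product_nodes (p : {poly C}) : exists2 k : R, 0 < k & forall m : nat,
  exists2 phi : R, 0 <= phi <= 2 * pi &
    k * cabs p.[0] ^+ (2 ^ m) <=
    \prod_(j < 2 ^ m) cabs p.[expi ((phi + 2 * pi * j%:R) / 2 ^+ m)].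
Proof.
have [s ps] := closed_field_poly_normal p.
pose A : R := 4 * (size s).+1%:R; have A0 : 0 < A by rewrite mulr_gt0.
exists (A^-1 ^+ size s) => [|m]; first by rewrite exprn_gt0 ?invr_gt0.
have [phi /andP[phi0 phipi] far] := expi_far_from [seq z ^+ (2 ^ m) | z <- s].
rewrite size_map -/A in far.
exists phi; first by rewrite phi0 (le_trans phipi) // ler_peMl ?pi_ge0 // ler1n.
have pE x : p.[x] = lead_coef p * \prod_(z <- s) (x - z).
  rewrite {1}ps hornerZ horner_prod; congr (_ * _).
  by apply: eq_bigr => z _; rewrite hornerXsubC.
under eq_bigr => j _ do rewrite pE cabsM cabs_prod.
rewrite big_split /= prodr_const card_ord exchange_big /=.
rewrite pE cabsM cabs_prod exprMn mulrCA ler_wpM2l ?exprn_ge0 ?cabs_ge0 //.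
rewrite -prodrXl.
have -> : A^-1 ^+ size s = \prod_(z <- s) A^-1.
  by rewrite big_const_seq count_predT -Monoid.iteropE.
rewrite -big_split /= !big_seq; apply: ler_prod => z zs.
rewrite mulr_ge0 ?invr_ge0 ?exprn_ge0 ?cabs_ge0 ?(ltW A0) //=.
under eq_bigr => j _ do rewrite cabs_subC.
rewrite -cabs_prod prod_expi_nodes sub0r cabsN -cabsX ler_pdivrMl //.
by apply: far; apply: map_f.
Qed.

Lemma ln_prod (I : Type) (r : seq I) (F : I -> R) : (forall i, 0 < F i) ->
  ln (\prod_(i <- r) F i) = \sum_(i <- r) ln (F i).
Proof.
move=> F0; elim: r => [|i r IH]; first by rewrite !big_nil ln1.
by rewrite !big_cons lnM ?IH // posrE // prodr_gt0.
Qed.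

(* Jensen's inequality is applied to the component [f] that dominates at the
   center; since [ln |f|] may have poles on the circle, it is only averaged over
   [2 ^ m] equidistant nodes away from the zeros of [f]. *)
Lemma ln_max_submean (p q : {poly C}) :
  (forall l : C, cabs l <= 1 -> 0 < cnorm (p.[l], q.[l])) ->
  econtinuous (fun th : R => ln (cnorm (p.[expi th], q.[expi th]))) ->
  ln (cnorm (p.[0], q.[0])) <= (2 * pi)^-1 *
    Rintegral lebesgue_measure `[0, 2 * pi]%classic
      (fun th : R => ln (cnorm (p.[expi th], q.[expi th]))).
Proof.
move=> pos hc.
have key (f : {poly C}) : (forall l, cabs f.[l] <= cnorm (p.[l], q.[l])) ->
    cabs f.[0] = cnorm (p.[0], q.[0]) ->
  ln (cnorm (p.[0], q.[0])) <= (2 * pi)^-1 *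
    Rintegral lebesgue_measure `[0, 2 * pi]%classic
      (fun th : R => ln (cnorm (p.[expi th], q.[expi th]))).
  move=> fle f0; have [k k0 hk] := poly_product_nodes f.
  apply: (@riemann_le_integral _ _ _ (- ln k)) => // m.
  have [phi phi2 h] := hk m; exists phi => //.
  have f00 : 0 < cabs f.[0] by rewrite f0 pos // cabs0.
  rewrite -f0 opprK -natrX mulr_natl -lnXn // addrC -lnM ?posrE ?exprn_gt0 //.
  rewrite -ln_prod; last by move=> j; rewrite pos // cabs_expi.
  have ge0 : 0 < k * cabs f.[0] ^+ (2 ^ m) by rewrite mulr_gt0 ?exprn_gt0.
  rewrite ler_ln ?posrE //; last first.
    by apply: prodr_gt0 => j _; rewrite pos // cabs_expi.
  apply: (le_trans h); apply: ler_prod => j _.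
  by rewrite natrX cabs_ge0 fle.
have [qp|pq] := leP (cabs q.[0]) (cabs p.[0]).
  apply: (key p) => [l|]; first exact: (cnorm_ge1 (p.[l], q.[l])).
  by rewrite /cnorm /= (max_l qp).
apply: (key q) => [l|]; first exact: (cnorm_ge2 (p.[l], q.[l])).
by rewrite /cnorm /= (max_r (ltW pq)).
Qed.

End SubMeanValue.

(** * Plurisubharmonic limits *)

Section PlurisubharmonicLimit.
Import numFieldNormedType.Exports.
Variable R : realType.
Local Notation C := R[i].

(** Subtracting the tail beyond [n + k] lets the geometric bound pass through the induction on
    [k]. *)
Lemma telescope_bound (u : nat -> R) (K : R) :
  (forall n, `|u n.+1 - u n| <= K / 2 ^+ n) ->
  forall n k, `|u (n + k)%N - u n| <= 2 * K / 2 ^+ n - 2 * K / 2 ^+ (n + k).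
Proof.
move=> hu n; elim=> [|k IH]; first by rewrite addn0 !subrr normr0.
rewrite addnS; have := hu (n + k)%N.
have := ler_normD (u (n + k).+1 - u (n + k)%N) (u (n + k)%N - u n).
rewrite addrA subrK.
have : 2 * K / 2 ^+ (n + k).+1 = K / 2 ^+ (n + k).
  by rewrite exprS; field; rewrite expf_neq0 // pnatr_eq0.
have : 2 * K / 2 ^+ (n + k) = 2 * (K / 2 ^+ (n + k)) by rewrite mulrA.
move: IH; lra.
Qed.

Lemma le_of_exp2 (x y K : R) : (forall n : nat, x <= y + K / 2 ^+ n) -> x <= y.
Proof.
move=> h; apply/ler_addgt0Pr => e e0.
have [m /(_ m (leqnn m)) hm] := exp2_large (K / e).
apply: (le_trans (h m)); rewrite lerD2l ler_pdivrMr ?exprn_gt0 // mulrC.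
by rewrite -ler_pdivrMr // ltW.
Qed.

(** The limit is chosen before [K], so pointwise limits can be collected into one function that
    obeys every local constant. It is [0] by default when no geometric bound holds. *)
Lemma telescope_limit (u : nat -> R) : exists l : R, forall K : R,
  (forall n, `|u n.+1 - u n| <= K / 2 ^+ n) ->
  forall n, `|u n - l| <= 2 * K / 2 ^+ n.
Proof.
have [[K0 hK0]|nK] := pselect (exists K, forall n, `|u n.+1 - u n| <= K / 2 ^+ n);
  last by exists 0 => K hK; case: nK; exists K.
have tb := telescope_bound hK0.
have K00 : 0 <= K0 by have := hK0 0%N; rewrite expr0 divr1; exact: le_trans.
(* Every [s n] is below every [t m], so the supremum of the [s n] lies between the two families. *)
pose s n : R := u n - 2 * K0 / 2 ^+ n; pose t n : R := u n + 2 * K0 / 2 ^+ n.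
have q0 n : 0 <= 2 * K0 / 2 ^+ n by rewrite divr_ge0 ?mulr_ge0 ?exprn_ge0.
have st n m : s n <= t m.
  have hn := tb n m; have hm := tb m n; rewrite addnC in hm.
  have := q0 (n + m)%N; rewrite /s /t; move: hn hm; rewrite !ler_norml.
  by move=> /andP[? ?] /andP[? ?]; lra.
pose E := [set x | exists n, x = s n]%classic.
have E0 : (E !=set0)%classic by exists (s 0%N), 0%N.
have ubE m : ubound E (t m) by move=> _ [n ->].
have sl n : s n <= sup E by apply: ub_le_sup; [exists (t 0%N) | exists n].
have lt_ n : sup E <= t n by apply: ge_sup.
have l0 n : `|u n - sup E| <= 2 * K0 / 2 ^+ n.
  by have := sl n; have := lt_ n; rewrite /s /t ler_norml; lra.
exists (sup E) => K hK n.
have K1 : 0 <= K by have := hK 0%N; rewrite expr0 divr1; exact: le_trans.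
apply: (@le_of_exp2 _ _ (2 * K0)) => k.
have h1 := telescope_bound hK n k.
have h2 := l0 (n + k)%N.
have h3 : 2 * K0 / 2 ^+ (n + k) <= 2 * K0 / 2 ^+ k.
  rewrite ler_wpM2l ?mulr_ge0 // lef_pV2 ?posrE ?exprn_gt0 //.
  by rewrite ler_weXn2l ?ler1n // leq_addl.
have h4 : 0 <= 2 * K / 2 ^+ (n + k) by rewrite divr_ge0 ?mulr_ge0 ?exprn_ge0.
have := ler_normD (u n - u (n + k)%N) (u (n + k)%N - sup E).
rewrite addrA subrK (distrC (u n) (u (n + k)%N)); lra.
Qed.

Definition circle (a b : C * C) (th : R) : C * C :=
  (a.1 + expi th * b.1, a.2 + expi th * b.2).

Lemma cabs_ReIm (z : C) : cabs z <= `|complex.Re z| + `|complex.Im z|.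
Proof.
case: z => x y /=; rewrite -(ger0_norm (addr_ge0 (normr_ge0 x) (normr_ge0 y))).
rewrite -sqrtr_sqr /cabs /= ler_wsqrtr // sqrrD !real_normK ?num_real //.
by rewrite addrAC lerDl mulrn_wge0 ?mulr_ge0.
Qed.

Lemma expi_continuous (th e : R) : 0 < e -> exists2 s : R, 0 < s &
  forall th', `|th' - th| < s -> cabs (expi th' - expi th) < e.
Proof.
move=> e0; have e20 : 0 < e / 2 by rewrite divr_gt0.
have cc (f : R -> R) : continuous f -> exists2 s : R, 0 < s &
    forall y, `|y - th| < s -> `|f y - f th| < e / 2.
  move=> /(_ th)/cvgrPdist_lt/(_ _ e20)/nbhs_ballP[s /= s0 hs].
  by exists s => // y yth; rewrite distrC; apply: hs; rewrite /ball /= distrC.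
have [s s0 hs] := cc _ (@continuous_cos R).
have [r r0 hr] := cc _ (@continuous_sin R).
exists (Num.min s r) => [|y]; first by rewrite lt_min s0.
rewrite lt_min => /andP[/hs h1 /hr h2].
by apply: le_lt_trans (cabs_ReIm _) _; rewrite /=; lra.
Qed.

Lemma circle_continuous (a b : C * C) (th r : R) : 0 < r -> exists2 s : R, 0 < s &
  forall th', `|th' - th| < s -> cdist (circle a b th') (circle a b th) < r.
Proof.
move=> r0; pose S := 1 + cnorm b.
have S0 : 0 < S by rewrite ltr_pwDl ?cnorm_ge0.
have [s s0 hs] := expi_continuous th (divr_gt0 r0 S0).
exists s => // y /hs h; rewrite ltr_pdivlMr // in h.
have aux (p q : C) : cabs q <= cnorm b ->
    cabs ((p + expi y * q) - (p + expi th * q)) < r.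
  move=> qb; have -> : (p + expi y * q) - (p + expi th * q) = (expi y - expi th) * q.
    by ring.
  rewrite cabsM; apply: le_lt_trans h; rewrite ler_wpM2l ?cabs_ge0 //.
  by rewrite (le_trans qb) // lerDr.
by rewrite gt_max !aux ?cnorm_ge1 ?cnorm_ge2.
Qed.

Definition sub_mean (G : C * C -> R) := forall a b : C * C,
  (forall l : C, cabs l <= 1 -> punct (a.1 + l * b.1, a.2 + l * b.2)) ->
  G a <= (2 * pi)^-1 *
    Rintegral lebesgue_measure `[0, 2 * pi]%classic (fun th => G (circle a b th)).

Lemma econtinuous_circle (G : C * C -> R) a b : continuous_on_punct G ->
  (forall th, punct (circle a b th)) -> econtinuous (fun th => G (circle a b th)).
Proof.
move=> cG pc th e e0; have [r r0 hr] := cG _ (pc th) e e0.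
have [s s0 hs] := circle_continuous a b th r0.
by exists s => // y /hs/hr; apply.
Qed.

Lemma rcont_on_punct (G : C * C -> R) :
  (forall x, punct x -> rcont G x) -> continuous_on_punct G.
Proof. by move=> cG x px e e0; have [r r0 hr] := cG x px e e0; exists r => // y _ /hr. Qed.

(** Geometric increments give the limit. Convergence is uniform on each circle, which carries the
    sub-mean value inequality over to it. *)
Lemma locally_uniform_limit (u : nat -> C * C -> R) :
  (forall n, continuous_on_punct (u n)) -> (forall n, sub_mean (u n)) ->
  (forall x, punct x -> exists K : R,
     nearby x (fun y => forall n, `|u n.+1 y - u n y| <= K / 2 ^+ n)) ->
  exists G, [/\ continuous_on_punct G, psh_on_punct G & loc_unif_cvg_punct u G].
Proof.
move=> cu su lu.
have [G hG] := choice (fun x => telescope_limit (u^~ x)).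
have lG x : punct x -> exists K : R,
    nearby x (fun y => forall n, `|u n y - G y| <= K / 2 ^+ n).
  move=> /lu[K hK]; exists (2 * K); apply: nearby_sub hK => y; exact: hG.
have small (K e : R) : 0 < e -> exists N : nat, forall n, (N <= n)%N -> K / 2 ^+ n < e.
  move=> e0; have [N hN] := exp2_large (K / e); exists N => n /hN.
  by rewrite ltr_pdivrMr // ltr_pdivrMr ?exprn_gt0 // mulrC.
have cG : continuous_on_punct G.
  move=> x px e e0; have [K [r r0 hr]] := lG x px.
  have e30 : 0 < e / 3 by rewrite divr_gt0.
  have [N /(_ N (leqnn N)) hN] := small K _ e30.
  have [r' r'0 hr'] := cu N x px _ e30.
  exists (Num.min r r') => [|y py]; first by rewrite lt_min r0.
  rewrite lt_min => /andP[/hr/(_ N) h1 /(hr' _ py) h2].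
  have h3 : `|u N x - G x| <= K / 2 ^+ N.
    by have /nearby_self : nearby x (fun y => forall n, `|u n y - G y| <= K / 2 ^+ n)
      by exists r.
  move: h1 h2 h3; rewrite !ler_norml !ltr_norml => /andP[? ?] /andP[? ?] /andP[? ?].
  apply/andP; split; lra.
exists G; split=> //; last first.
  move=> x px; have [K [r r0 hr]] := lG x px; exists r => // e e0.
  have [N hN] := small K e e0; exists N => n nN y _ /hr/(_ n) h.
  exact: le_lt_trans (hN n nN).
split=> [x px e e0|a b pab].
  have [r r0 hr] := cG x px e e0; exists r => // y py yx.
  by have := hr y py yx; rewrite ltr_norml; lra.
have pa : punct a.
  have := pab 0; rewrite cabs0 !mul0r !addr0 -surjective_pairing; apply.
  exact: ler01.
have pc th : punct (circle a b th) by apply: pab; rewrite cabs_expi.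
have pi2 : 0 < 2 * pi :> R by rewrite mulr_gt0 // pi_gt0.
have [Ka /nearby_self hKa] := lG a pa.
(* Gluing arcs turns the local constants into a single one for the whole circle. *)
pose Q s t := exists K : R, forall th, s <= th <= t ->
  forall n, `|u n (circle a b th) - G (circle a b th)| <= K / 2 ^+ n.
have [K hK] : Q 0 (2 * pi).
  apply: interval_glue (ltW pi2) _ _ => [s t v st tv [K hK] [K' hK']|th].
    exists (Num.max K K') => th /andP[s_th th_v] n.
    have [tht|/ltW tth] := leP th t.
      apply: le_trans (hK th _ n) _; first by rewrite s_th.
      by rewrite ler_wpM2r ?invr_ge0 ?exprn_ge0 // le_max lexx.
    apply: le_trans (hK' th _ n) _; first by rewrite tth.
    by rewrite ler_wpM2r ?invr_ge0 ?exprn_ge0 // le_max lexx orbT.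
  have [K [r r0 hr]] := lG _ (pc th).
  have [s s0 hs] := circle_continuous a b th r0.
  exists s => // v w v1 vw w1; exists K => y /andP[vy yw].
  by apply: hr; apply: hs; rewrite ltr_norml; lra.
apply: (@le_of_exp2 _ _ (Ka + K)) => n.
have h1 : G a <= u n a + Ka / 2 ^+ n.
  by have := hKa n; rewrite ler_norml; lra.
apply: (le_trans h1); 
rewrite [Ka + K]addrC [(K + Ka) / _]mulrDl addrA lerD2r.
apply: (le_trans (su n a b pab)); rewrite ler_pdivrMl //.
have eq_mean (X Y : R) : 2 * pi * ((2 * pi)^-1 * X + Y) = X + 2 * pi * Y.
  by rewrite mulrDr mulVKf // gt_eqF.
rewrite eq_mean.
have iG := @econtinuous_integrable _ _ 0 (2 * pi) (econtinuous_circle cG pc).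
have iu := @econtinuous_integrable _ _ 0 (2 * pi) (econtinuous_circle (cu n) pc).
have ec : econtinuous (fun=> K / 2 ^+ n : R).
  by move=> z e e0; exists 1 => // y _; rewrite subrr normr0.
have ic := @econtinuous_integrable _ _ 0 (2 * pi) ec.
have -> : 2 * pi * (K / 2 ^+ n) =
    Rintegral lebesgue_measure `[0, 2 * pi]%classic (fun=> K / 2 ^+ n).
  rewrite Rintegral_cst // [X in _ * fine X]lebesgue_measure_itv /= lte_fin pi2 /=.
  by rewrite subr0 mulrC.
rewrite -RintegralD //; apply: le_Rintegral => //.
  apply: (@econtinuous_integrable _ (fun th => G (circle a b th) + K / 2 ^+ n)).
  move=> z e /(econtinuous_circle cG pc z)[r r0 hr]; exists r => // y /hr.
  by rewrite opprD addrACA subrr addr0.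
move=> th; rewrite /= in_itv /= => /hK/(_ n); rewrite ler_norml; lra.
Qed.

(** On a complex line [l |-> a + l b] both forms become polynomials in [l], to which
    [ln_max_submean] applies. *)
Lemma polynomial_sub_mean (P Q : bipoly R) (c : R) : 0 <= c ->
  (forall x, punct x -> 0 < cnorm (evm x P, evm x Q)) ->
  continuous_on_punct (fun x => ln (cnorm (evm x P, evm x Q)) * c) /\
  sub_mean (fun x => ln (cnorm (evm x P, evm x Q)) * c).
Proof.
move=> c0 pos.
have cl : continuous_on_punct (fun x => ln (cnorm (evm x P, evm x Q))).
  apply: rcont_on_punct => x px; apply: rcont_ln; first exact: pos.
  by apply: rcont_cnorm; exact: ccont_evm.
split=> [x px e e0|a b pab].
  (* Unlike [c], which may be [0], this can be divided by. *)
  have c1 : 0 < c + 1 by rewrite ltr_wpDl.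
  have [r r0 hr] := cl x px _ (divr_gt0 e0 c1).
  exists r => // y py /(hr y py); rewrite -mulrBl normrM (ger0_norm c0).
  rewrite ltr_pdivlMr //; apply: le_lt_trans.
  by rewrite ler_wpM2l // lerDl.
pose u : {poly C} := a.1%:P + 'X * b.1%:P; pose v : {poly C} := a.2%:P + 'X * b.2%:P.
have ue l : u.[l] = a.1 + l * b.1 by rewrite !(hornerD, hornerM, hornerX, hornerC).
have ve l : v.[l] = a.2 + l * b.2 by rewrite !(hornerD, hornerM, hornerX, hornerC).
have se F l : (subst u v F).[l] = evm (a.1 + l * b.1, a.2 + l * b.2) F.
  by rewrite horner_subst ue ve.
have pc th : punct (circle a b th) by apply: pab; rewrite cabs_expi.
have ce := econtinuous_circle cl pc.
have := @ln_max_submean R (subst u v P) (subst u v Q).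
rewrite !se !mul0r !addr0 -surjective_pairing.
have -> : (fun th : R => ln (cnorm ((subst u v P).[expi th], (subst u v Q).[expi th])))
    = (fun th => ln (cnorm (evm (circle a b th) P, evm (circle a b th) Q))).
  by apply/funext => th; rewrite !se.
move=> /(_ _ ce) h.
rewrite RintegralZr //; last exact: econtinuous_integrable.
rewrite mulrA ler_wpM2r //; apply: h => l l1; rewrite !se.
by apply: pos; exact: pab.
Qed.

End PlurisubharmonicLimit.

(** * The iterates as pairs of homogeneous polynomials *)

Section Iterates.
Variable R : realType.

(** The factor [t2^2] removed by the recursion splits off identically, and the shape [(A, t2 B)]
    persists. *)
Lemma Fmap_dup (A B : bipoly R) :
  Fmap (A, t2 R * B) = (t2 R ^+ 2 * (dup (t1 R) (t2 R) (A, B)).1,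
                        t2 R ^+ 2 * (t2 R * (dup (t1 R) (t2 R) (A, B)).2)).
Proof. by rewrite /Fmap /dup /=; congr (_, _); ring. Qed.

Lemma Fmap_homog (A B : bipoly R) d : homog A d -> homog B d ->
  homog (Fmap (A, B)).1 (2 + 4 * d) /\ homog (Fmap (A, B)).2 (2 + 4 * d).
Proof.
move=> hA hB; have h1 := @homog_t1 R; have h2 := @homog_t2 R.
have hD : homog (t1 R * B - t2 R * A) (1 + d).
  by apply: homogD; [|apply: homogN]; apply: homogM.
split; rewrite /Fmap /=.
  have -> : (2 + 4 * d = 2 * (1 + 2 * d))%N by lia.
  apply: homogX; apply: homogD; [|apply: homogN]; apply: homogM => //; exact: homogX.
have -> : (2 + 4 * d = 0 + 1 + d + d + d + (1 + d))%N by lia.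
apply: homogM => //; apply: homogM; last by apply: homogD => //; exact: homogN.
apply: homogM => //; apply: homogM => //; apply: homogM => //; exact: homog_nat.
Qed.

Definition iterates (A B : bipoly R) n := iter n (dup (t1 R) (t2 R)) (A, B).

Lemma evm_dup x (v : bipoly R * bipoly R) :
  (evm x (dup (t1 R) (t2 R) v).1, evm x (dup (t1 R) (t2 R) v).2) =
  dup x.1 x.2 (evm x v.1, evm x v.2).
Proof.
rewrite /dup /=; congr (_, _).
  by rewrite !expr2 rmorphM rmorphB !rmorphM /= evm_t1 evm_t2.
do 4 rewrite rmorphM; rewrite rmorph_nat 2!rmorphB 2!rmorphM.
by rewrite /= evm_t1 evm_t2.
Qed.

Lemma evm_iterates (A B : bipoly R) n x :
  (evm x (iterates A B n).1, evm x (iterates A B n).2) = orbit A B n x.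
Proof.
elim: n => // n IH; rewrite /orbit /= -/(orbit A B n x) -IH.
by rewrite -evm_dup.
Qed.

End Iterates.

Theorem theorem1p5 (R : realType) (c : {fraction {poly R[i]}})
    (c1 c2 : bipoly R) (g P1 Q1 : bipoly R) (d : nat) :
  c != 0 -> c != 1 -> c != ('X)%:F ->
  homogeneous_lift c c1 c2 ->
  (* F_1 = F_{t1,t2}(C) / gcd(F_{t1,t2}(C)) *)
  g != 0 -> (Fmap (c1, c2)).1 = g * P1 -> (Fmap (c1, c2)).2 = g * Q1 ->
  no_common_factor P1 Q1 ->
  (* d = deg F_1 *)
  homog P1 d -> homog Q1 d ->
  exists Fs : nat -> bipoly R * bipoly R,
    [/\ Fs 0%N = (P1, Q1),
        (* F_{n+1} = F_{t1,t2}(F_n) / t2^2 *)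
        (forall n : nat, Fmap (Fs n) =
           (t2 R ^+ 2 * (Fs n.+1).1, t2 R ^+ 2 * (Fs n.+1).2)),
        (* deg F_n = 4^(n-1) d *)
        (forall n : nat, homog (Fs n).1 (4 ^ n * d) /\ homog (Fs n).2 (4 ^ n * d)) &
        exists G : R[i] * R[i] -> R,
          [/\ continuous_on_punct G, psh_on_punct G &
              loc_unif_cvg_punct
                (fun n x => ln (cnorm (evF (Fs n) x)) / (4 ^ n * d)%:R) G]].
Proof.
move=> _ _ _ [k [hc1 hc2 nc _ _]] _ eP eQ nc1 hP hQ.
have nzc x : punct x -> ~ (evm x c1 = 0 /\ evm x c2 = 0).
  exact: no_common_zero hc1 hc2 nc.
have nz1 x : punct x -> ~ (evm x P1 = 0 /\ evm x Q1 = 0).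
  exact: no_common_zero hP hQ nc1.
have nz_t1 := first_iterate_t1_axis nzc nz1 eP eQ.
have nz_t2 := first_iterate_t2_axis nzc nz1 eP eQ.
have nz_diag := first_iterate_diagonal nzc nz1 eP eQ.
(* The zero of [Q1] on the line [t2 = 0] gives [F_1 = (P1, t2 B)]. *)
have [B eB] := homog_t2_dvd hQ (nz_t2 1 (oner_neq0 _)).2.
have evB x : evm x Q1 = x.2 * evm x B by rewrite eB rmorphM /= evm_t2.
have nzB x : punct x -> ~ (evm x P1 = 0 /\ evm x B = 0).
  by move=> /nz1 h [e1 e2]; apply: h; rewrite evB e2 mulr0.
have nz_t2' t : t != 0 -> evm (t, 0) P1 != 0 by move=> /nz_t2[].
have nz_diag' t : t != 0 -> evm (t, t) P1 - t * evm (t, t) B != 0.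
  by move=> /nz_diag; rewrite evB subr_eq0.
have growth := local_growth nzB nz_t1 nz_t2' nz_diag'.
(* [Fs n] stands for [F_(n+1)], whence the degree [4 ^ n * d]. *)
pose Fs n := ((iterates P1 B n).1, t2 R * (iterates P1 B n).2).
have rec n : Fmap (Fs n) = (t2 R ^+ 2 * (Fs n.+1).1, t2 R ^+ 2 * (Fs n.+1).2).
  by rewrite Fmap_dup -surjective_pairing.
exists Fs; split=> //; first by rewrite eB.
  elim=> [|n [IH1 IH2]]; first by rewrite mul1n /Fs /= -eB.
  have [] := Fmap_homog IH1 IH2; rewrite -surjective_pairing rec expnS -mulnA.
  by move=> /homog_mult2 ? /homog_mult2.
have sizeE n x : cnorm (evm x (Fs n).1, evm x (Fs n).2) = size_at P1 B n x.
  by rewrite /size_at -evm_iterates /= rmorphM /= evm_t2.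
have pos n x : punct x -> 0 < cnorm (evm x (Fs n).1, evm x (Fs n).2).
  by move=> /growth[K /nearby_self/(_ n)[]]; rewrite sizeE.
have deg_ge0 n : 0 <= (4 ^ n * d)%:R^-1 :> R by rewrite invr_ge0.
apply: locally_uniform_limit => [n|n|x /growth[K hK]].
- by have [] := polynomial_sub_mean (deg_ge0 n) (pos n).
- by have [] := polynomial_sub_mean (deg_ge0 n) (pos n).
exists (K / d%:R); apply: nearby_sub hK => y hy n.
have [_ h] := hy n.
rewrite /evF !evE !sizeE expnS -!mulnA !natrM natrX.
(* For [d = 0] division by the degree returns [0], so the increments vanish. *)
have [->|d0] := eqVneq d 0%N.
  by rewrite !(mulr0, invr0, mul0r) subrr normr0.
have dr : 0 < d%:R :> R by rewrite ltr0n lt0n.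
have p4 : 0 < 4 ^+ n :> R by rewrite exprn_gt0.
have p2 : 0 < 2 ^+ n :> R by rewrite exprn_gt0.
set w' := ln _ in h *; set w := ln (size_at P1 B n y) in h *.
have -> : w' / (4 * (4 ^+ n * d%:R)) - w / (4 ^+ n * d%:R) =
    (w' - 4 * w) / (4 * (4 ^+ n * d%:R)) by field; rewrite !gt_eqF.
rewrite normrM (ger0_norm (_ : 0 <= (4 * (4 ^+ n * d%:R))^-1)); last first.
  by rewrite invr_ge0 !mulr_ge0 ?(ltW p4) ?(ltW dr).
rewrite ler_pdivrMr ?mulr_gt0 //; apply: (le_trans h).
(* An error [K * 2 ^+ n] divided by the degree [4 * 4 ^+ n * d] decays geometrically with ratio
   [1 / 2]. *)
have e42 : 4 ^+ n = 2 ^+ n * 2 ^+ n :> R by rewrite -exprMn -natrM.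
have -> : K / d%:R / 2 ^+ n * (4 * (4 ^+ n * d%:R)) = 4 * (K * 2 ^+ n).
  by rewrite e42; field; rewrite !gt_eqF.
have : 0 <= K * 2 ^+ n by apply: le_trans h.
lra.
Qed.
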